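(* Let $\omega_1,\omega_2\in\mathbb C$ with $\omega_1/\omega_2\notin\mathbb R$, let $\Lambda=\{a\omega_1+b\omega_2: a,b\in\mathbb Z\}$, and let $f$ be an elliptic function on $\Lambda$. Then, inside a fundamental parallelogram, $f$ has the same number of zeros as poles (counted with multiplicity).
   Context: Given $\omega_1,\omega_2\in\mathbb C$ with $\omega_1/\omega_2\notin\mathbb R$, a meromorphic function $f$ on $\mathbb C$ is called an elliptic function (on the lattice $\Lambda$ generated by $\omega_1,\omega_2$) if $f(z+\omega_1)=f(z+\omega_2)=f(z)$ for all $z\in\mathbb C$. The fundamental parallelogram is the parallelogram in $\mathbb C$ with vertices $0$, $\omega_1$, $\omega_2$, and $\omega_1+\omega_2$. *)

(* Defs.v *)
From Stdlib Require Import Reals List.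
From Coquelicot Require Import Coquelicot.

Open Scope C_scope.

(* A meromorphic function takes values in the Riemann sphere [option C],
   where [None] is the point at infinity. *)

Definition holomorphic_at (g : C -> C) (p : C) : Prop :=
  locally p (fun z => @ex_derive C_AbsRing C_NormedModule g z).

Definition regular_at (f : C -> option C) (p : C) : Prop :=
  exists g : C -> C,
    holomorphic_at g p /\ locally p (fun z => f z = Some (g z)).

Definition zero_of_order (f : C -> option C) (p : C) (n : nat) : Prop :=
  (0 < n)%nat /\
  exists g : C -> C,
    holomorphic_at g p /\ g p <> 0 /\
    locally p (fun z => f z = Some ((z - p) ^ n * g z)).

Definition pole_of_order (f : C -> option C) (p : C) (n : nat) : Prop :=
  (0 < n)%nat /\ f p = None /\
  exists g : C -> C,
    holomorphic_at g p /\ g p <> 0 /\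
    locally' p (fun z => f z = Some (g z / (z - p) ^ n)).

Definition meromorphic (f : C -> option C) : Prop :=
  forall p : C, regular_at f p \/ exists n : nat, pole_of_order f p n.

(* Poles are covered too: these are equalities in the Riemann sphere. *)
Definition elliptic (w1 w2 : C) (f : C -> option C) : Prop :=
  meromorphic f /\ forall z : C, f (z + w1) = f z /\ f (z + w2) = f z.

(* Half-open, so that each class modulo the lattice has exactly one
   representative; zeros and poles may lie on the boundary. *)
Definition fundamental_parallelogram (w1 w2 z : C) : Prop :=
  exists s t : R,
    (0 <= s < 1)%R /\ (0 <= t < 1)%R /\ z = RtoC s * w1 + RtoC t * w2.

(* The points of [A] are finitely many, each [p] in [A] has a multiplicity [m]
   with [mult p m], and these multiplicities add up to [N]. *)
Definition count_with_mult (A : C -> Prop) (mult : C -> nat -> Prop) (N : nat)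
  : Prop :=
  exists l : list (C * nat),
    NoDup (map fst l) /\
    (forall p : C, In p (map fst l) <-> A p) /\
    (forall (p : C) (m : nat), In (p, m) l -> mult p m) /\
    N = list_sum (map snd l).

Definition number_of_zeros (D : C -> Prop) (f : C -> option C) (N : nat)
  : Prop :=
  count_with_mult (fun p => D p /\ f p = Some (RtoC 0)) (zero_of_order f) N.

Definition number_of_poles (D : C -> Prop) (f : C -> option C) (N : nat)
  : Prop :=
  count_with_mult (fun p => D p /\ f p = None) (pole_of_order f) N.

(* Main.v *)
(* The regularised logarithmic derivative [lam] of [f], which at [p] equals
   [h' p / h p] when [f z = (z - p) ^ k * h z] near [p] with [h p <> 0], is periodic,
   so its integral over the boundary of any period parallelogram vanishes. Only
   finitely many zeros and poles are nearby, so the fundamental parallelogram can be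
   shifted by [- e (w1 + w2)], with [e] small, to a closed one that contains the same
   zeros and poles, all of them in its interior. There [lam] minus the sum of the
   [ord p / (z - p)] is holomorphic, so Goursat's theorem gives
   [0 = K * (sum of the orders)], where [K <> 0] is the integral of [1 / z] around
   the origin.

   All integrals are taken over parallelograms with sides parallel to [w1] and [w2].
   Cauchy's formula on them gives holomorphy of derivatives and of divided
   differences, hence the orders of zeros; the identity theorem, finiteness of the
   divisor and Goursat's estimate all come from one bisection principle. *)

Require Import Defs.
From Stdlib Require Import Reals List.
From Coquelicot Require Import Coquelicot.
From Stdlib Require Import ZArith Lra Lia ClassicalEpsilon.

Local Open Scope R_scope.

(** * Continuity and complex derivatives *)

(** The value of [lam] at a singular point is the value that the holomorphic extension of [lam]
    minus the principal part takes there. So this difference is differentiable at every point as it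
    stands. Divided differences are treated in the same spirit: they are defined by a Cauchy
    integral, which makes sense at the centre too. Orders of zeros come from Cauchy's estimate: a
    function divisible by every power of [z - p] on a fixed box must vanish near [p].

    Parallelograms are the natural contours. The periods carry each side of a period parallelogram
    to the opposite one, and quartering a parallelogram keeps its shape. The constant [K] is nonzero
    because its imaginary part adds up the four angles under which the sides are seen from the
    origin, all of the same sign.

    The shift is forced by zeros and poles on the sides of the half-open parallelogram, where the
    contour would run through singularities. The zero function has infinitely many zeros and no
    orders. The identity theorem turns its exclusion into a local statement: [f] is not zero on any
    neighbourhood, so every point has an order. *)

Definition near (p : C) (P : C -> Prop) : Prop :=
  exists d : R, 0 < d /\ forall z : C, Cmod (z - p) < d -> P z.

Lemma locally_near (p : C) (P : C -> Prop) : locally p P <-> near p P.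
Proof.
  split.
  - intros H. apply locally_C in H. destruct H as [e He].
    exists e. split; [apply cond_pos|]. intros z Hz. apply He. exact Hz.
  - intros [d [Hd H]]. apply locally_C. exists (mkposreal d Hd).
    intros z Hz. apply H. exact Hz.
Qed.

Lemma near_and (p : C) (P Q : C -> Prop) :
  near p P -> near p Q -> near p (fun z => P z /\ Q z).
Proof.
  intros [d [Hd H]] [e [He K]]. exists (Rmin d e).
  split; [apply Rmin_pos; assumption|]. intros z Hz. split.
  - apply H. pose proof (Rmin_l d e). lra.
  - apply K. pose proof (Rmin_r d e). lra.
Qed.

Lemma near_impl (p : C) (P Q : C -> Prop) :
  (forall z, P z -> Q z) -> near p P -> near p Q.
Proof. intros PQ [d [Hd H]]. exists d. split; auto. Qed.

Lemma near_all (p : C) (P : C -> Prop) : (forall z, P z) -> near p P.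
Proof. intros H. exists 1. split; [lra|auto]. Qed.

Lemma Cminus_diag (p : C) : (p - p)%C = RtoC 0.
Proof. ring. Qed.

Lemma near_self (p : C) (P : C -> Prop) : near p P -> P p.
Proof.
  intros [d [Hd H]]. apply H. rewrite Cminus_diag, Cmod_0. exact Hd.
Qed.

Lemma near_near (p : C) (P : C -> Prop) :
  near p P -> near p (fun q => near q P).
Proof.
  intros [d [Hd H]]. exists (d / 2). split; [lra|]. intros q Hq.
  exists (d / 2). split; [lra|]. intros z Hz. apply H.
  replace (z - p)%C with ((z - q) + (q - p))%C by ring.
  pose proof (Cmod_triangle (z - q) (q - p)). lra.
Qed.

Lemma near_neq (p q : C) : p <> q -> near p (fun z => z <> q).
Proof.
  intros H. exists (Cmod (p - q)). split.
  - apply Cmod_gt_0. intros E. apply H. apply Ceq_minus. exact E.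
  - intros z Hz E. subst z.
    replace (q - p)%C with (- (p - q))%C in Hz by ring.
    rewrite Cmod_opp in Hz. lra.
Qed.

Definition near' (p : C) (P : C -> Prop) : Prop := near p (fun z => z <> p -> P z).

Lemma near'_off (p : C) (P : C -> Prop) :
  near' p P -> near' p (fun q => near q P).
Proof.
  intros H. apply near_near in H. revert H. apply near_impl. intros q Hq Hqp.
  generalize (near_and _ _ _ Hq (near_neq q p Hqp)). apply near_impl.
  intros z [H1 H2]. auto.
Qed.

Lemma near'_exists (p : C) (P : C -> Prop) :
  near' p P -> exists z, z <> p /\ P z.
Proof.
  intros [d [Hd H]]. exists (p + RtoC (d / 2))%C.
  assert (E : (p + RtoC (d / 2) - p)%C = RtoC (d / 2)) by ring.
  assert (N : (p + RtoC (d / 2))%C <> p).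
  { intros F. rewrite F, Cminus_diag in E. apply RtoC_inj in E. lra. }
  split; [exact N|]. apply H; [|exact N].
  rewrite E, Cmod_R, Rabs_pos_eq; lra.
Qed.

Definition Ccontinuous_at (F : C -> C) (p : C) : Prop :=
  forall e : R, 0 < e -> near p (fun z => Cmod (F z - F p) < e).

(** The weak inequality holds trivially at [z = p], so the estimate can be asked on a full
    neighbourhood. *)
Definition is_Cderive (F : C -> C) (p d : C) : Prop :=
  forall e : R, 0 < e ->
    near p (fun z => Cmod (F z - F p - d * (z - p)) <= e * Cmod (z - p)).

Lemma is_derive_is_Cderive (F : C -> C) (p d : C) :
  @is_derive C_AbsRing C_NormedModule F p d <-> is_Cderive F p d.
Proof.
  split.
  - intros [_ H] e He. specialize (H p (fun P HP => HP) (mkposreal e He)).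
    apply locally_near. apply locally_C. revert H.
    apply filter_imp. intros z Hz.
    replace (d * (z - p))%C with ((z - p) * d)%C by ring. exact Hz.
  - intros H. split; [apply is_linear_scal_l|].
    (* Coquelicot asks for the estimate at every limit [x] of the filter; by separation the only one
       is [p]. *)
    intros x Hx. assert (E := @is_filter_lim_locally_unique C_AbsRing (AbsRing_NormedModule C_AbsRing) _ _ Hx). subst x.
    intros e. specialize (H e (cond_pos e)).
    apply locally_near in H. apply locally_C in H. revert H.
    apply filter_imp. intros z Hz.
    change (Cmod (F z - F p - (z - p) * d) <= e * Cmod (z - p)).
    replace ((z - p) * d)%C with (d * (z - p))%C by ring. exact Hz.
Qed.

Lemma Ccontinuous_near (F : C -> C) (p : C) (P : C -> Prop) :
  Ccontinuous_at F p -> near (F p) P -> near p (fun z => P (F z)).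
Proof.
  intros H [e [He K]]. generalize (H e He). apply near_impl. auto.
Qed.

Lemma Ccontinuous_ext (F G : C -> C) (p : C) :
  near p (fun z => F z = G z) -> Ccontinuous_at F p -> Ccontinuous_at G p.
Proof.
  intros E H e He. generalize (near_and _ _ _ E (H e He)).
  apply near_impl. intros z [E1 E2]. rewrite <- E1, <- (near_self _ _ E). exact E2.
Qed.

Lemma is_Cderive_ext (F G : C -> C) (p d : C) :
  near p (fun z => F z = G z) -> is_Cderive F p d -> is_Cderive G p d.
Proof.
  intros E H e He. generalize (near_and _ _ _ E (H e He)).
  apply near_impl. intros z [E1 E2]. rewrite <- E1, <- (near_self _ _ E). exact E2.
Qed.

Lemma Ccontinuous_const (c p : C) : Ccontinuous_at (fun _ => c) p.
Proof.
  intros e He. apply near_all. intros z. rewrite Cminus_diag, Cmod_0. exact He.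
Qed.

Lemma Ccontinuous_id (p : C) : Ccontinuous_at (fun z => z) p.
Proof. intros e He. exists e. split; auto. Qed.

Lemma Ccontinuous_plus (F G : C -> C) (p : C) :
  Ccontinuous_at F p -> Ccontinuous_at G p -> Ccontinuous_at (fun z => F z + G z)%C p.
Proof.
  intros HF HG e He.
  generalize (near_and _ _ _ (HF (e / 2) ltac:(lra)) (HG (e / 2) ltac:(lra))).
  apply near_impl. intros z [H1 H2].
  replace (F z + G z - (F p + G p))%C with ((F z - F p) + (G z - G p))%C by ring.
  pose proof (Cmod_triangle (F z - F p) (G z - G p)). lra.
Qed.

Lemma Ccontinuous_bounded (F : C -> C) (p : C) :
  Ccontinuous_at F p -> near p (fun z => Cmod (F z) <= Cmod (F p) + 1).
Proof.
  intros H. generalize (H 1 ltac:(lra)). apply near_impl. intros z Hz.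
  replace (F z) with ((F z - F p) + F p)%C by ring.
  pose proof (Cmod_triangle (F z - F p) (F p)). lra.
Qed.

Lemma Ccontinuous_mult (F G : C -> C) (p : C) :
  Ccontinuous_at F p -> Ccontinuous_at G p -> Ccontinuous_at (fun z => F z * G z)%C p.
Proof.
  intros HF HG e He.
  set (a := Cmod (F p) + 1). set (b := Cmod (G p) + 1).
  assert (Ha : 0 < a) by (pose proof (Cmod_ge_0 (F p)); unfold a; lra).
  assert (Hb : 0 < b) by (pose proof (Cmod_ge_0 (G p)); unfold b; lra).
  generalize (near_and _ _ _ (near_and _ _ _
    (HF (e / (2 * b)) ltac:(apply Rdiv_lt_0_compat; lra))
    (HG (e / (2 * a)) ltac:(apply Rdiv_lt_0_compat; lra)))
    (Ccontinuous_bounded F p HF)).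
  apply near_impl. intros z [[H1 H2] H3].
  replace (F z * G z - F p * G p)%C
    with (F z * (G z - G p) + (F z - F p) * G p)%C by ring.
  eapply Rle_lt_trans; [apply Cmod_triangle|]. rewrite !Cmod_mult.
  assert (Cmod (F z) * Cmod (G z - G p) <= e / 2).
  { replace (e / 2) with (a * (e / (2 * a))) by (field; lra).
    apply Rmult_le_compat; try apply Cmod_ge_0; unfold a in *; lra. }
  assert (Cmod (F z - F p) * Cmod (G p) < e / 2).
  { replace (e / 2) with (e / (2 * b) * b) by (field; lra).
    pose proof (Cmod_ge_0 (F z - F p)). pose proof (Cmod_ge_0 (G p)).
    unfold b in *. nra. }
  lra.
Qed.

Lemma Ccontinuous_inv (F : C -> C) (p : C) :
  F p <> RtoC 0 -> Ccontinuous_at F p -> Ccontinuous_at (fun z => / F z)%C p.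
Proof.
  intros N H e He. apply Cmod_gt_0 in N as M. set (m := Cmod (F p)) in *.
  (* Near [p] one has [Cmod (F z) >= m / 2], so the difference of the inverses is at most
     [Cmod (F z - F p) / (m * m / 2)]. *)
  assert (P1 : 0 < e * (m * m / 2)) by (apply Rmult_lt_0_compat; nra).
  generalize (near_and _ _ _ (H (m / 2) ltac:(lra)) (H _ P1)).
  apply near_impl. intros z [H1 H2].
  assert (L : m / 2 <= Cmod (F z)).
  { pose proof (Cmod_triangle (F z) (F p - F z)) as T.
    replace (F z + (F p - F z))%C with (F p) in T by ring.
    replace (F p - F z)%C with (- (F z - F p))%C in T by ring.
    rewrite Cmod_opp in T. fold m in T. lra. }
  assert (Nz : F z <> RtoC 0) by (apply Cmod_gt_0; lra).
  replace (/ F z - / F p)%C with (- (F z - F p) / (F z * F p))%C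
    by (field; split; assumption).
  rewrite Cmod_div by (apply Cmult_neq_0; assumption).
  rewrite Cmod_opp, Cmod_mult. fold m.
  assert (0 < Cmod (F z) * m) by (apply Rmult_lt_0_compat; lra).
  apply Rlt_div_l; [assumption|]. eapply Rlt_le_trans; [exact H2|].
  apply Rmult_le_compat_l; [lra|]. nra.
Qed.

(** Carathéodory's criterion: the slope function, completed by [d] at [p], is continuous there. It
    reduces the rules for sums, products and inverses to the same rules for continuity and an
    algebraic identity. *)
Lemma caratheodory (F : C -> C) (p d : C) :
  is_Cderive F p d <->
  exists g, Ccontinuous_at g p /\ g p = d /\ forall z, F z = (F p + g z * (z - p))%C.
Proof.
  split.
  - intros H.
    exists (fun z => if excluded_middle_informative (z = p) then d
                     else (F z - F p) / (z - p))%C.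
    split; [|split].
    + intros e He. generalize (H (e / 2) ltac:(lra)). apply near_impl.
      intros z Hz.
      destruct (excluded_middle_informative (p = p)) as [_|N]; [|congruence].
      destruct (excluded_middle_informative (z = p)) as [E|N].
      { rewrite Cminus_diag, Cmod_0. exact He. }
      assert (N' : (z - p)%C <> RtoC 0).
      { intros E. apply N, Ceq_minus, E. }
      apply Cmod_gt_0 in N' as M.
      replace ((F z - F p) / (z - p) - d)%C
        with ((F z - F p - d * (z - p)) / (z - p))%C by (field; exact N').
      rewrite Cmod_div by exact N'.
      apply Rlt_div_l; [exact M|]. nra.
    + destruct (excluded_middle_informative (p = p)); congruence.
    + intros z. destruct (excluded_middle_informative (z = p)) as [E|N].
      * subst z. ring.
      * field. intros E. apply N, Ceq_minus, E.
  - intros [g [Hg [Ed E]]] e He. generalize (Hg e He). apply near_impl.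
    intros z Hz. rewrite (E z), <- Ed.
    replace (F p + g z * (z - p) - F p - g p * (z - p))%C
      with ((g z - g p) * (z - p))%C by ring.
    rewrite Cmod_mult. apply Rmult_le_compat_r; [apply Cmod_ge_0|lra].
Qed.

Lemma is_Cderive_continuous (F : C -> C) (p d : C) : is_Cderive F p d -> Ccontinuous_at F p.
Proof.
  intros H. apply caratheodory in H. destruct H as [g [Hg [_ E]]].
  apply Ccontinuous_ext with (fun z => F p + g z * (z + - p))%C.
  { apply near_all. intros z. symmetry. apply E. }
  apply Ccontinuous_plus; [apply Ccontinuous_const|]. apply Ccontinuous_mult; [exact Hg|].
  apply Ccontinuous_plus; [apply Ccontinuous_id|apply Ccontinuous_const].
Qed.

Lemma is_Cderive_const (c p : C) : is_Cderive (fun _ => c) p (RtoC 0).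
Proof.
  apply caratheodory. exists (fun _ => RtoC 0).
  split; [apply Ccontinuous_const|]. split; [reflexivity|]. intros z. ring.
Qed.

Lemma is_Cderive_id (p : C) : is_Cderive (fun z => z) p (RtoC 1).
Proof.
  apply caratheodory. exists (fun _ => RtoC 1).
  split; [apply Ccontinuous_const|]. split; [reflexivity|]. intros z. ring.
Qed.

Lemma is_Cderive_plus (F G : C -> C) (p d e : C) :
  is_Cderive F p d -> is_Cderive G p e -> is_Cderive (fun z => F z + G z)%C p (d + e)%C.
Proof.
  intros HF HG. apply caratheodory in HF. apply caratheodory in HG.
  destruct HF as [f [Hf [Ef EF]]], HG as [g [Hg [Eg EG]]].
  apply caratheodory. exists (fun z => f z + g z)%C.
  split; [apply Ccontinuous_plus; assumption|]. split; [congruence|].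
  intros z. rewrite (EF z), (EG z). ring.
Qed.

Lemma is_Cderive_mult (F G : C -> C) (p d e : C) :
  is_Cderive F p d -> is_Cderive G p e -> is_Cderive
    (fun z => F z * G z)%C p (d * G p + F p * e)%C.
Proof.
  intros HF HG. pose proof (is_Cderive_continuous _ _ _ HG) as CG.
  apply caratheodory in HF. apply caratheodory in HG.
  destruct HF as [f [Hf [Ef EF]]], HG as [g [Hg [Eg EG]]].
  apply caratheodory. exists (fun z => f z * G z + F p * g z)%C.
  split; [|split].
  - apply Ccontinuous_plus; apply Ccontinuous_mult; try assumption. apply Ccontinuous_const.
  - congruence.
  - intros z. rewrite (EF z). rewrite (EG z). ring.
Qed.

Lemma is_Cderive_inv (F : C -> C) (p d : C) :
  F p <> RtoC 0 -> is_Cderive F p d -> is_Cderive (fun z => / F z)%C p (- d / (F p * F p))%C.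
Proof.
  intros N HF. pose proof (is_Cderive_continuous _ _ _ HF) as CF.
  apply caratheodory in HF. destruct HF as [f [Hf [Ef EF]]].
  (* The slope of [/ F] is [- f z / (F z * F p)], an identity valid only where [F z <> 0]. The
     right-hand side is therefore taken as the function, which agrees with [/ F] near [p]. *)
  apply is_Cderive_ext with
    (fun z => / F p + (- f z * / (F z * F p)) * (z - p))%C.
  { generalize (Ccontinuous_near F p (fun w => w <> RtoC 0) CF (near_neq _ _ N)).
    apply near_impl. intros z Hz. rewrite (EF z) in Hz |- *. field. split; assumption. }
  apply caratheodory. exists (fun z => - f z * / (F z * F p))%C.
  split; [|split].
  - apply Ccontinuous_mult.
    + apply Ccontinuous_ext with (fun z => RtoC (-1) * f z)%C;
        [apply near_all; intros z; ring|].
      apply Ccontinuous_mult; [apply Ccontinuous_const|exact Hf].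
    + apply Ccontinuous_inv; [apply Cmult_neq_0; assumption|].
      apply Ccontinuous_mult; [exact CF|apply Ccontinuous_const].
  - rewrite Ef. reflexivity.
  - intros z. ring.
Qed.

Lemma is_Cderive_unique (F : C -> C) (p d e : C) : is_Cderive F p d -> is_Cderive F p e -> d = e.
Proof.
  intros H K. apply Ceq_minus. destruct (Ceq_dec (d - e)%C (RtoC 0)) as [E|N]; [exact E|].
  exfalso. apply Cmod_gt_0 in N. set (m := Cmod (d - e)) in *.
  (* At a point [z <> p] of both neighbourhoods the two estimates add up to
     [m * Cmod (z - p) <= m / 2 * Cmod (z - p)], which is absurd. *)
  pose proof (near_and _ _ _ (H (m / 4) ltac:(lra)) (K (m / 4) ltac:(lra))) as L.
  assert (L' : near' p (fun z => Cmod (F z - F p - d * (z - p)) <= m / 4 * Cmod (z - p)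
    /\ Cmod (F z - F p - e * (z - p)) <= m / 4 * Cmod (z - p))).
  { revert L. apply near_impl. auto. }
  apply near'_exists in L'. destruct L' as [z [Hz [H1 H2]]].
  assert (M : 0 < Cmod (z - p)).
  { apply Cmod_gt_0. intros E. apply Hz, Ceq_minus, E. }
  assert (T : m * Cmod (z - p) <= m / 4 * Cmod (z - p) + m / 4 * Cmod (z - p)).
  { unfold m at 1. rewrite <- Cmod_mult.
    replace ((d - e) * (z - p))%C with
      ((F z - F p - e * (z - p)) + - (F z - F p - d * (z - p)))%C by ring.
    eapply Rle_trans; [apply Cmod_triangle|]. rewrite Cmod_opp. lra. }
  nra.
Qed.

Definition Cdifferentiable (F : C -> C) (p : C) : Prop := exists d, is_Cderive F p d.

Lemma holomorphic_near (g : C -> C) (p : C) :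
  holomorphic_at g p <-> near p (Cdifferentiable g).
Proof.
  unfold holomorphic_at. rewrite locally_near.
  split; apply near_impl; intros z [d H]; exists d; apply is_derive_is_Cderive; exact H.
Qed.

Lemma Cdifferentiable_continuous (F : C -> C) (p : C) : Cdifferentiable F p -> Ccontinuous_at F p.
Proof. intros [d H]. apply is_Cderive_continuous with d. exact H. Qed.

Lemma Cdifferentiable_ext (F G : C -> C) (p : C) :
  near p (fun z => F z = G z) -> Cdifferentiable F p -> Cdifferentiable G p.
Proof. intros E [d H]. exists d. apply is_Cderive_ext with F; assumption. Qed.

Lemma Cdifferentiable_const (c p : C) : Cdifferentiable (fun _ => c) p.
Proof. eexists. apply is_Cderive_const. Qed.

Lemma Cdifferentiable_id (p : C) : Cdifferentiable (fun z => z) p.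
Proof. eexists. apply is_Cderive_id. Qed.

Lemma Cdifferentiable_plus (F G : C -> C) (p : C) :
  Cdifferentiable F p -> Cdifferentiable G p -> Cdifferentiable (fun z => F z + G z)%C p.
Proof. intros [d H] [e K]. eexists. apply is_Cderive_plus; eassumption. Qed.

Lemma Cdifferentiable_mult (F G : C -> C) (p : C) :
  Cdifferentiable F p -> Cdifferentiable G p -> Cdifferentiable (fun z => F z * G z)%C p.
Proof. intros [d H] [e K]. eexists. apply is_Cderive_mult; eassumption. Qed.

Lemma Cdifferentiable_opp (F : C -> C) (p : C) :
  Cdifferentiable F p -> Cdifferentiable (fun z => - F z)%C p.
Proof.
  intros H. apply Cdifferentiable_ext with (fun z => RtoC (-1) * F z)%C.
  - apply near_all. intros z. ring.
  - apply Cdifferentiable_mult; [apply Cdifferentiable_const|exact H].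
Qed.

Lemma Cdifferentiable_minus (F G : C -> C) (p : C) :
  Cdifferentiable F p -> Cdifferentiable G p -> Cdifferentiable (fun z => F z - G z)%C p.
Proof. intros H K. apply Cdifferentiable_plus; [|apply Cdifferentiable_opp]; assumption. Qed.

Lemma Cdifferentiable_div (F G : C -> C) (p : C) :
  G p <> RtoC 0 -> Cdifferentiable F p -> Cdifferentiable G p -> Cdifferentiable
    (fun z => F z / G z)%C p.
Proof.
  intros N H [e K]. apply Cdifferentiable_mult; [exact H|].
  eexists. apply is_Cderive_inv; eassumption.
Qed.

Lemma Cdifferentiable_pow (F : C -> C) (p : C) (n : nat) :
  Cdifferentiable F p -> Cdifferentiable (fun z => F z ^ n)%C p.
Proof.
  intros H. induction n as [|n IH]; simpl; [apply Cdifferentiable_const|].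
  apply Cdifferentiable_mult; assumption.
Qed.

Lemma Cdifferentiable_translate (p : C) (c : C) : Cdifferentiable (fun z => z - c)%C p.
Proof. apply Cdifferentiable_minus; [apply Cdifferentiable_id|apply Cdifferentiable_const]. Qed.

(** * Boundary integrals over parallelograms *)

Lemma Cmod_pair_le (z : C) : Cmod z <= Rabs (fst z) + Rabs (snd z).
Proof.
  replace z with (RtoC (fst z) + Ci * RtoC (snd z))%C.
  - eapply Rle_trans; [apply Cmod_triangle|].
    rewrite Cmod_mult, Cmod_Ci, !Cmod_R. destruct z; simpl.
    replace (r + (0 * r0 - 1 * 0)) with r by ring.
    replace (0 + (0 * 0 + 1 * r0)) with r0 by ring. lra.
  - apply injective_projections; simpl; ring.
Qed.

(** Integrating the two components separately makes the theory of real integrals applicable as it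
    is. *)
Definition CRInt (F : R -> C) (a b : R) : C :=
  (RInt (fun t => fst (F t)) a b, RInt (fun t => snd (F t)) a b).

Definition RCcontinuous (F : R -> C) (x : R) : Prop :=
  continuous (fun t => fst (F t)) x /\ continuous (fun t => snd (F t)) x.

Definition RCcontinuous_on (F : R -> C) (a b : R) : Prop := forall x, a <= x <= b ->
  RCcontinuous F x.

Lemma RCcontinuous_on_ex_RInt (F : R -> C) (a b : R) :
  a <= b -> RCcontinuous_on F a b ->
  ex_RInt (fun t => fst (F t)) a b /\ ex_RInt (fun t => snd (F t)) a b.
Proof.
  intros Hab H.
  split; apply (ex_RInt_continuous (V := R_CompleteNormedModule));
    rewrite Rmin_left, Rmax_right by exact Hab;
    intros x Hx; apply (H x Hx).
Qed.

Lemma CRInt_plus (F G : R -> C) (a b : R) :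
  a <= b -> RCcontinuous_on F a b -> RCcontinuous_on G a b ->
  CRInt (fun t => F t + G t)%C a b = (CRInt F a b + CRInt G a b)%C.
Proof.
  intros Hab HF HG.
  destruct (RCcontinuous_on_ex_RInt F a b Hab HF), (RCcontinuous_on_ex_RInt G a b Hab HG).
  apply injective_projections; simpl.
  - apply (RInt_plus (fun t => fst (F t)) (fun t => fst (G t))); assumption.
  - apply (RInt_plus (fun t => snd (F t)) (fun t => snd (G t))); assumption.
Qed.

Lemma CRInt_scal (F : R -> C) (c : C) (a b : R) :
  a <= b -> RCcontinuous_on F a b -> CRInt (fun t => c * F t)%C a b = (c * CRInt F a b)%C.
Proof.
  intros Hab HF. destruct (RCcontinuous_on_ex_RInt F a b Hab HF) as [H1 H2].
  pose (V := R_CompleteNormedModule).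
  apply injective_projections; simpl.
  - etransitivity.
    + exact (RInt_minus (V := V) (fun t => scal (fst c) (fst (F t)))
        (fun t => scal (snd c) (snd (F t))) a b
        (ex_RInt_scal _ _ _ _ H1) (ex_RInt_scal _ _ _ _ H2)).
    + exact (f_equal2 minus (RInt_scal (V := V) _ _ _ (fst c) H1)
        (RInt_scal (V := V) _ _ _ (snd c) H2)).
  - etransitivity.
    + exact (RInt_plus (V := V) (fun t => scal (fst c) (snd (F t)))
        (fun t => scal (snd c) (fst (F t))) a b
        (ex_RInt_scal _ _ _ _ H2) (ex_RInt_scal _ _ _ _ H1)).
    + exact (f_equal2 plus (RInt_scal (V := V) _ _ _ (fst c) H2)
        (RInt_scal (V := V) _ _ _ (snd c) H1)).
Qed.

Lemma CRInt_ext (F G : R -> C) (a b : R) :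
  a <= b -> (forall t, a <= t <= b -> F t = G t) -> CRInt F a b = CRInt G a b.
Proof.
  intros Hab H. unfold CRInt. f_equal; apply RInt_ext;
    rewrite Rmin_left, Rmax_right by exact Hab; intros t Ht;
    rewrite H by lra; reflexivity.
Qed.

Lemma CRInt_Chasles (F : R -> C) (a b c : R) :
  a <= b -> b <= c -> RCcontinuous_on F a c -> CRInt F a c = (CRInt F a b + CRInt F b c)%C.
Proof.
  intros Hab Hbc H.
  assert (H1 : RCcontinuous_on F a b) by (intros x Hx; apply H; lra).
  assert (H2 : RCcontinuous_on F b c) by (intros x Hx; apply H; lra).
  destruct (RCcontinuous_on_ex_RInt F a b Hab H1), (RCcontinuous_on_ex_RInt F b c Hbc H2).
  apply injective_projections; simpl; symmetry.
  - apply (RInt_Chasles (fun t => fst (F t))); assumption.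
  - apply (RInt_Chasles (fun t => snd (F t))); assumption.
Qed.

(** The factor [2] comes from estimating the real and imaginary parts separately. A crude constant
    suffices, since the bounds are only used for limits equal to [0]. *)
Lemma CRInt_bound (F : R -> C) (M a b : R) :
  a <= b -> RCcontinuous_on F a b -> (forall t, a <= t <= b -> Cmod (F t) <= M) ->
  Cmod (CRInt F a b) <= 2 * M * (b - a).
Proof.
  intros Hab H HM. destruct (RCcontinuous_on_ex_RInt F a b Hab H) as [H1 H2].
  eapply Rle_trans; [apply Cmod_pair_le|]. simpl.
  assert (Rabs (RInt (fun t => fst (F t)) a b) <= (b - a) * M).
  { apply abs_RInt_le_const; try assumption. intros t Ht.
    eapply Rle_trans; [|apply HM, Ht]. apply re_le_Cmod. }
  assert (Rabs (RInt (fun t => snd (F t)) a b) <= (b - a) * M).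
  { apply abs_RInt_le_const; try assumption. intros t Ht.
    eapply Rle_trans; [|apply HM, Ht].
    eapply Rle_trans; [|apply Rmax_Cmod]. apply Rmax_r. }
  lra.
Qed.

Lemma Ccontinuous_RC (F : C -> C) (w u : C) (x : R) :
  Ccontinuous_at F (RtoC x * w + u)%C -> RCcontinuous (fun s => F (RtoC s * w + u)%C) x.
Proof.
  intros H.
  assert (K : forall e, 0 < e -> exists d, 0 < d /\ forall s, Rabs (s - x) < d ->
    Cmod (F (RtoC s * w + u)%C - F (RtoC x * w + u)%C) < e).
  { intros e He. destruct (H e He) as [d [Hd K]].
    pose proof (Cmod_ge_0 w) as W.
    exists (d / (Cmod w + 1)). split; [apply Rdiv_lt_0_compat; lra|].
    intros s Hs. apply K.
    replace (RtoC s * w + u - (RtoC x * w + u))%C with (RtoC (s - x) * w)%C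
      by (rewrite RtoC_minus; ring).
    rewrite Cmod_mult, Cmod_R. apply Rlt_div_r in Hs; [|lra].
    pose proof (Rabs_pos (s - x)). nra. }
  split; apply filterlim_locally; intros [e He]; destruct (K e He) as [d [Hd L]];
    exists (mkposreal d Hd); intros s Hs; specialize (L s Hs).
  - eapply Rle_lt_trans; [|exact L].
    change (Rabs (Re (F (RtoC s * w + u)%C - F (RtoC x * w + u)%C)) <=
      Cmod (F (RtoC s * w + u)%C - F (RtoC x * w + u)%C)). apply re_le_Cmod.
  - eapply Rle_lt_trans; [|exact L].
    eapply Rle_trans; [|apply Rmax_Cmod].
    change (Rabs (snd (F (RtoC s * w + u)%C - F (RtoC x * w + u)%C)%C) <=
      Rmax (Rabs (fst (F (RtoC s * w + u)%C - F (RtoC x * w + u)%C)%C))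
      (Rabs (snd (F (RtoC s * w + u)%C - F (RtoC x * w + u)%C)%C))).
    apply Rmax_r.
Qed.

(** This is the integral of [F z dz] along the segment from [a * w + u] to [b * w + u]; the factor
    [w] is the derivative of the parametrisation. *)
Definition edge_integral (F : C -> C) (w u : C) (a b : R) : C :=
  (w * CRInt (fun s => F (RtoC s * w + u)) a b)%C.

Definition Ccontinuous_on (F : C -> C) (w u : C) (a b : R) : Prop :=
  forall s, a <= s <= b -> Ccontinuous_at F (RtoC s * w + u)%C.

Lemma Ccontinuous_on_RC (F : C -> C) (w u : C) (a b : R) :
  Ccontinuous_on F w u a b -> RCcontinuous_on (fun s => F (RtoC s * w + u)%C) a b.
Proof. intros H x Hx. apply Ccontinuous_RC, H, Hx. Qed.

Lemma edge_integral_plus (F G : C -> C) (w u : C) (a b : R) :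
  a <= b -> Ccontinuous_on F w u a b -> Ccontinuous_on G w u a b ->
  edge_integral (fun z => F z + G z)%C w u a b =
    (edge_integral F w u a b + edge_integral G w u a b)%C.
Proof.
  intros Hab HF HG. unfold edge_integral.
  rewrite (CRInt_plus (fun s => F (RtoC s * w + u)%C) (fun s => G (RtoC s * w + u)%C));
    [ring|exact Hab|apply Ccontinuous_on_RC; assumption|apply Ccontinuous_on_RC; assumption].
Qed.

Lemma edge_integral_scal (F : C -> C) (c w u : C) (a b : R) :
  a <= b -> Ccontinuous_on F w u a b ->
  edge_integral (fun z => c * F z)%C w u a b = (c * edge_integral F w u a b)%C.
Proof.
  intros Hab HF. unfold edge_integral.
  rewrite (CRInt_scal (fun s => F (RtoC s * w + u)%C)); [ring|exact Hab|].
  apply Ccontinuous_on_RC; assumption.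
Qed.

Lemma edge_integral_ext (F G : C -> C) (w u : C) (a b : R) :
  a <= b ->
  (forall s, a <= s <= b -> F (RtoC s * w + u)%C = G (RtoC s * w + u)%C) ->
  edge_integral F w u a b = edge_integral G w u a b.
Proof. intros Hab H. unfold edge_integral. f_equal. apply CRInt_ext; assumption. Qed.

Lemma edge_integral_Chasles (F : C -> C) (w u : C) (a b c : R) :
  a <= b -> b <= c -> Ccontinuous_on F w u a c ->
  edge_integral F w u a c = (edge_integral F w u a b + edge_integral F w u b c)%C.
Proof.
  intros Hab Hbc H. unfold edge_integral. rewrite (CRInt_Chasles _ a b c); [ring|assumption..|].
  apply Ccontinuous_on_RC; assumption.
Qed.

Lemma edge_integral_bound (F : C -> C) (w u : C) (M a b : R) :
  a <= b -> Ccontinuous_on F w u a b ->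
  (forall s, a <= s <= b -> Cmod (F (RtoC s * w + u)%C) <= M) ->
  Cmod (edge_integral F w u a b) <= 2 * Cmod w * M * (b - a).
Proof.
  intros Hab H HM. unfold edge_integral. rewrite Cmod_mult.
  replace (2 * Cmod w * M * (b - a)) with (Cmod w * (2 * M * (b - a))) by ring.
  apply Rmult_le_compat_l; [apply Cmod_ge_0|].
  apply CRInt_bound; try assumption. apply Ccontinuous_on_RC; assumption.
Qed.

Lemma RInt_id (a b : R) : RInt (fun t => t) a b = (b * b - a * a) / 2.
Proof.
  apply is_RInt_unique.
  replace ((b * b - a * a) / 2) with (minus (b * b / 2) (a * a / 2))
    by (unfold minus, plus, opp; simpl; field).
  apply (is_RInt_derive (fun t => t * t / 2) (fun t => t)).
  - intros x _. auto_derive; [exact I|field].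
  - intros x _. apply continuous_id.
Qed.

Lemma CRInt_const (c : C) (a b : R) : CRInt (fun _ => c) a b = (RtoC (b - a) * c)%C.
Proof.
  unfold CRInt. rewrite !RInt_const.
  apply injective_projections; simpl; unfold scal; simpl; unfold mult; simpl; ring.
Qed.

Lemma CRInt_RtoC (a b : R) : CRInt RtoC a b = RtoC ((b * b - a * a) / 2).
Proof.
  unfold CRInt; simpl. rewrite RInt_id, RInt_const.
  apply injective_projections; simpl; [reflexivity|].
  unfold scal; simpl; unfold mult; simpl; ring.
Qed.

Lemma RCcontinuous_const (c : C) (x : R) : RCcontinuous (fun _ => c) x.
Proof. split; apply continuous_const. Qed.

Lemma RCcontinuous_RtoC (x : R) : RCcontinuous RtoC x.
Proof. split; [apply continuous_id|apply continuous_const]. Qed.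

Lemma edge_integral_affine (A B w u : C) (a b : R) :
  a <= b ->
  edge_integral (fun z => A + B * z)%C w u a b =
  (w * RtoC (b - a) * (A + B * u) + B * w * w * RtoC ((b * b - a * a) / 2))%C.
Proof.
  intros Hab. unfold edge_integral.
  rewrite (CRInt_ext _ (fun s => (A + B * u) + (B * w) * RtoC s)%C);
    [|exact Hab|intros; ring].
  assert (K : RCcontinuous_on RtoC a b) by (intros x _; apply RCcontinuous_RtoC).
  assert (L : RCcontinuous_on (fun s => (B * w) * RtoC s)%C a b).
  { intros x _. generalize (Ccontinuous_RC (fun z => z) (B * w) (RtoC 0) x (Ccontinuous_id _)).
    intros [H1 H2].
    split; eapply continuous_ext; [|exact H1| |exact H2]; intros t; simpl; ring. }
  rewrite CRInt_plus; [|exact Hab|intros x _; apply RCcontinuous_const|exact L].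
  rewrite CRInt_scal by assumption. rewrite CRInt_const, CRInt_RtoC. ring.
Qed.

(* Counterclockwise if [Im (w2 / w1) > 0]. *)
Definition bd_integral (w1 w2 : C) (F : C -> C) (s1 s2 t1 t2 : R) : C :=
  (edge_integral F w1 (RtoC t1 * w2) s1 s2 + edge_integral F w2 (RtoC s2 * w1) t1 t2
   - edge_integral F w1 (RtoC t2 * w2) s1 s2 - edge_integral F w2 (RtoC s1 * w1) t1 t2)%C.

Definition pt (w1 w2 : C) (s t : R) : C := (RtoC s * w1 + RtoC t * w2)%C.

Definition on_bd (s1 s2 t1 t2 s t : R) : Prop :=
  s1 <= s <= s2 /\ t1 <= t <= t2 /\ (s = s1 \/ s = s2 \/ t = t1 \/ t = t2).

Definition bd_all (w1 w2 : C) (s1 s2 t1 t2 : R) (P : C -> Prop) : Prop :=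
  forall s t, on_bd s1 s2 t1 t2 s t -> P (pt w1 w2 s t).

Lemma bd_all_edges (w1 w2 : C) (s1 s2 t1 t2 : R) (P : C -> Prop) :
  s1 <= s2 -> t1 <= t2 -> bd_all w1 w2 s1 s2 t1 t2 P ->
  (forall s, s1 <= s <= s2 -> P (RtoC s * w1 + RtoC t1 * w2)%C) /\
  (forall s, s1 <= s <= s2 -> P (RtoC s * w1 + RtoC t2 * w2)%C) /\
  (forall t, t1 <= t <= t2 -> P (RtoC t * w2 + RtoC s1 * w1)%C) /\
  (forall t, t1 <= t <= t2 -> P (RtoC t * w2 + RtoC s2 * w1)%C).
Proof.
  intros Hs Ht H. repeat split; intros x Hx.
  - apply H. unfold on_bd; intuition lra.
  - apply H. unfold on_bd; intuition lra.
  - rewrite Cplus_comm. apply H. unfold on_bd; intuition lra.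
  - rewrite Cplus_comm. apply H. unfold on_bd; intuition lra.
Qed.

Lemma bd_integral_plus (w1 w2 : C) (F G : C -> C) (s1 s2 t1 t2 : R) :
  s1 <= s2 -> t1 <= t2 ->
  bd_all w1 w2 s1 s2 t1 t2 (Ccontinuous_at F) -> bd_all w1 w2 s1 s2 t1 t2 (Ccontinuous_at G) ->
  bd_integral w1 w2 (fun z => F z + G z)%C s1 s2 t1 t2 =
  (bd_integral w1 w2 F s1 s2 t1 t2 + bd_integral w1 w2 G s1 s2 t1 t2)%C.
Proof.
  intros Hs Ht HF HG.
  destruct (bd_all_edges _ _ _ _ _ _ _ Hs Ht HF) as [F1 [F2 [F3 F4]]].
  destruct (bd_all_edges _ _ _ _ _ _ _ Hs Ht HG) as [G1 [G2 [G3 G4]]].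
  unfold bd_integral. rewrite !edge_integral_plus by assumption. ring.
Qed.

Lemma bd_integral_scal (w1 w2 : C) (F : C -> C) (c : C) (s1 s2 t1 t2 : R) :
  s1 <= s2 -> t1 <= t2 -> bd_all w1 w2 s1 s2 t1 t2 (Ccontinuous_at F) ->
  bd_integral w1 w2 (fun z => c * F z)%C s1 s2 t1 t2 = (c * bd_integral w1 w2 F s1 s2 t1 t2)%C.
Proof.
  intros Hs Ht HF.
  destruct (bd_all_edges _ _ _ _ _ _ _ Hs Ht HF) as [F1 [F2 [F3 F4]]].
  unfold bd_integral. rewrite !edge_integral_scal by assumption. ring.
Qed.

Lemma bd_integral_ext (w1 w2 : C) (F G : C -> C) (s1 s2 t1 t2 : R) :
  s1 <= s2 -> t1 <= t2 ->
  bd_all w1 w2 s1 s2 t1 t2 (fun z => F z = G z) ->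
  bd_integral w1 w2 F s1 s2 t1 t2 = bd_integral w1 w2 G s1 s2 t1 t2.
Proof.
  intros Hs Ht H.
  destruct (bd_all_edges _ _ _ _ _ _ _ Hs Ht H) as [H1 [H2 [H3 H4]]].
  unfold bd_integral. f_equal; [f_equal; [f_equal|]|]; apply edge_integral_ext; assumption.
Qed.

Lemma bd_integral_bound (w1 w2 : C) (F : C -> C) (M s1 s2 t1 t2 : R) :
  s1 <= s2 -> t1 <= t2 -> bd_all w1 w2 s1 s2 t1 t2 (Ccontinuous_at F) ->
  bd_all w1 w2 s1 s2 t1 t2 (fun z => Cmod (F z) <= M) ->
  Cmod (bd_integral w1 w2 F s1 s2 t1 t2) <=
  4 * M * (Cmod w1 * (s2 - s1) + Cmod w2 * (t2 - t1)).
Proof.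
  intros Hs Ht HF H.
  destruct (bd_all_edges _ _ _ _ _ _ _ Hs Ht HF) as [F1 [F2 [F3 F4]]].
  destruct (bd_all_edges _ _ _ _ _ _ _ Hs Ht H) as [H1 [H2 [H3 H4]]].
  pose proof (edge_integral_bound _ _ _ _ _ _ Hs F1 H1).
  pose proof (edge_integral_bound _ _ _ _ _ _ Hs F2 H2).
  pose proof (edge_integral_bound _ _ _ _ _ _ Ht F3 H3).
  pose proof (edge_integral_bound _ _ _ _ _ _ Ht F4 H4).
  unfold bd_integral, Cminus.
  eapply Rle_trans; [apply Cmod_triangle|]. rewrite Cmod_opp.
  eapply Rle_trans; [apply Rplus_le_compat_r, Cmod_triangle|]. rewrite Cmod_opp.
  eapply Rle_trans; [apply Rplus_le_compat_r, Rplus_le_compat_r, Cmod_triangle|].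
  lra.
Qed.

Lemma bd_integral_split_s (w1 w2 : C) (F : C -> C) (s1 s s2 t1 t2 : R) :
  s1 <= s -> s <= s2 -> t1 <= t2 -> bd_all w1 w2 s1 s2 t1 t2 (Ccontinuous_at F) ->
  bd_integral w1 w2 F s1 s2 t1 t2 =
  (bd_integral w1 w2 F s1 s t1 t2 + bd_integral w1 w2 F s s2 t1 t2)%C.
Proof.
  intros H1 H2 Ht HF.
  destruct (bd_all_edges w1 w2 s1 s2 t1 t2 _ ltac:(lra) Ht HF) as [F1 [F2 _]].
  unfold bd_integral. rewrite !(edge_integral_Chasles F w1 _ s1 s s2) by assumption. ring.
Qed.

Lemma bd_integral_split_t (w1 w2 : C) (F : C -> C) (s1 s2 t1 t t2 : R) :
  s1 <= s2 -> t1 <= t -> t <= t2 -> bd_all w1 w2 s1 s2 t1 t2 (Ccontinuous_at F) ->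
  bd_integral w1 w2 F s1 s2 t1 t2 =
  (bd_integral w1 w2 F s1 s2 t1 t + bd_integral w1 w2 F s1 s2 t t2)%C.
Proof.
  intros Hs H1 H2 HF.
  destruct (bd_all_edges w1 w2 s1 s2 t1 t2 _ Hs ltac:(lra) HF) as [_ [_ [F1 F2]]].
  unfold bd_integral. rewrite !(edge_integral_Chasles F w2 _ t1 t t2) by assumption. ring.
Qed.

(** Goursat's estimate subtracts the tangent affine function from [F]. That this does not change the
    integral is read off from the explicit values on the four edges. *)
Lemma bd_integral_affine (w1 w2 A B : C) (s1 s2 t1 t2 : R) :
  s1 <= s2 -> t1 <= t2 ->
  bd_integral w1 w2 (fun z => A + B * z)%C s1 s2 t1 t2 = RtoC 0.
Proof.
  intros Hs Ht. unfold bd_integral. rewrite !edge_integral_affine by assumption.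
  rewrite !RtoC_minus. ring.
Qed.

(** * Bisection and Goursat's theorem *)

(** The supremum of the left ends works, because every left end lies below every right end. *)
Lemma nested_segments (a l : nat -> R) :
  (forall n, 0 <= l n) ->
  (forall n, a n <= a (S n) /\ a (S n) + l (S n) <= a n + l n) ->
  exists x, forall n, a n <= x <= a n + l n.
Proof.
  intros Hl H.
  assert (M1 : forall n k, a n <= a (n + k)%nat /\ a (n + k)%nat + l (n + k)%nat <= a n + l n).
  { intros n k. induction k as [|k IH].
    - rewrite Nat.add_0_r. lra.
    - rewrite Nat.add_succ_r. specialize (H (n + k)%nat). lra. }
  assert (M : forall m n, a m <= a n + l n).
  { intros m n. destruct (Nat.le_ge_cases m n) as [L|L].
    - replace n with (m + (n - m))%nat by lia.
      generalize (M1 m (n - m)%nat) (Hl (m + (n - m))%nat). lra.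
    - replace m with (n + (m - n))%nat by lia.
      generalize (M1 n (m - n)%nat) (Hl (n + (m - n))%nat). lra. }
  destruct (completeness (fun y => exists n, y = a n)) as [x [U L]].
  - exists (a 0%nat + l 0%nat). intros y [n ->]. apply M.
  - exists (a 0%nat). exists 0%nat. reflexivity.
  - exists x. intros n. split.
    + apply U. exists n. reflexivity.
    + apply L. intros y [m ->]. apply M.
Qed.

(* A property of boxes that is additive under cutting and holds for all small
   boxes of the given shape around each point holds for the whole box: otherwise
   repeated quartering would produce bad boxes shrinking to a point. *)
Lemma box_induction (Q : R -> R -> R -> R -> Prop) (S1 S2 T1 T2 : R) :
  S1 < S2 -> T1 < T2 ->
  (forall a m b c d, S1 <= a < m -> m < b <= S2 -> T1 <= c < d -> d <= T2 ->
    Q a m c d -> Q m b c d -> Q a b c d) ->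
  (forall a b c m d, S1 <= a < b -> b <= S2 -> T1 <= c < m -> m < d <= T2 ->
    Q a b c m -> Q a b m d -> Q a b c d) ->
  (forall x y, S1 <= x <= S2 -> T1 <= y <= T2 ->
    exists e, 0 < e /\ forall r a c, 0 < r < e ->
      S1 <= a <= x -> x <= a + r * (S2 - S1) <= S2 ->
      T1 <= c <= y -> y <= c + r * (T2 - T1) <= T2 ->
      Q a (a + r * (S2 - S1)) c (c + r * (T2 - T1))) ->
  Q S1 S2 T1 T2.
Proof.
  intros HS HT addS addT loc. apply NNPP. intros notQ.
  set (r := fun n => (1 / 2) ^ n).
  assert (Hr : forall n, 0 < r n) by (intros n; apply pow_lt; lra).
  assert (Hr2 : forall n, r n = 2 * r (S n)) by (intros n; unfold r; simpl; lra).
  set (W := S2 - S1). set (H := T2 - T1).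
  set (bad := fun n (u : R * R) =>
    (S1 <= fst u /\ fst u + r n * W <= S2) /\ (T1 <= snd u /\ snd u + r n * H <= T2) /\
    ~ Q (fst u) (fst u + r n * W) (snd u) (snd u + r n * H)).
  set (next := fun n (u v : R * R) => bad (S n) v /\
    (fst u <= fst v /\ fst v + r (S n) * W <= fst u + r n * W) /\
    (snd u <= snd v /\ snd v + r (S n) * H <= snd u + r n * H)).
  assert (step : forall n u, bad n u -> exists v, next n u v).
  { intros n [a c] [Ha [Hc HQ]]. simpl in Ha, Hc, HQ.
    set (h := r (S n) * W). set (k := r (S n) * H).
    assert (Hh : 0 < h) by (unfold h, W; apply Rmult_lt_0_compat; [apply Hr|lra]).
    assert (Hk : 0 < k) by (unfold k, H; apply Rmult_lt_0_compat; [apply Hr|lra]).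
    assert (Eh : r n * W = 2 * h) by (unfold h; rewrite Hr2; ring).
    assert (Ek : r n * H = 2 * k) by (unfold k; rewrite Hr2; ring).
    rewrite Eh in Ha. rewrite Ek in Hc. rewrite Eh, Ek in HQ.
    (* If no quarter were bad, all four would satisfy [Q]; gluing them into two vertical strips and
       then the strips together would give [Q] for the whole box. *)
    apply NNPP. intros no.
    assert (good : forall a' c', (a' = a \/ a' = a + h) -> (c' = c \/ c' = c + k) ->
      Q a' (a' + h) c' (c' + k)).
    { intros a' c' Ea Ec. apply NNPP. intros N. apply no. exists (a', c').
      unfold next, bad; simpl. fold h k. rewrite Eh, Ek.
      split; [split; [|split; [|exact N]]|split]; lra. }
    apply HQ. apply addS with (a + h); try lra.
    - apply addT with (c + k); try lra; [apply good; tauto|].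
      replace (c + 2 * k) with (c + k + k) by ring. apply good; tauto.
    - replace (a + 2 * h) with (a + h + h) by ring.
      apply addT with (c + k); try lra; [apply good; tauto|].
      replace (c + 2 * k) with (c + k + k) by ring. apply good; tauto. }
  (* [epsilon] makes the choice of a bad quarter total, so the sequence can be defined before it is
     known that bad quarters exist; [Hu] proves that afterwards by induction. *)
  set (u := fix u n := match n with O => (S1, T1)
    | S k => epsilon (inhabits (S1, T1)) (next k (u k)) end).
  assert (Hu : forall n, bad n (u n)).
  { induction n as [|n IH].
    - unfold bad, r, W, H; simpl.
      replace (S1 + 1 * (S2 - S1)) with S2 by ring.
      replace (T1 + 1 * (T2 - T1)) with T2 by ring.
      split; [lra|split; [lra|exact notQ]].
    - destruct (epsilon_spec (inhabits (S1, T1)) (next n (u n)) (step n _ IH)) as [B _].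
      exact B. }
  assert (Hn : forall n, next n (u n) (u (S n))).
  { intros n. exact (epsilon_spec (inhabits (S1, T1)) (next n (u n)) (step n _ (Hu n))). }
  destruct (nested_segments (fun n => fst (u n)) (fun n => r n * W)) as [x Hx].
  { intros n. unfold W. apply Rmult_le_pos; [apply Rlt_le, Hr|lra]. }
  { intros n. apply (Hn n). }
  destruct (nested_segments (fun n => snd (u n)) (fun n => r n * H)) as [y Hy].
  { intros n. unfold H. apply Rmult_le_pos; [apply Rlt_le, Hr|lra]. }
  { intros n. apply (Hn n). }
  assert (X : S1 <= x <= S2).
  { generalize (Hx 0%nat). unfold r, W; simpl. lra. }
  assert (Y : T1 <= y <= T2).
  { generalize (Hy 0%nat). unfold r, H; simpl. lra. }
  destruct (loc x y X Y) as [e [He K]].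
  destruct (pow_lt_1_zero (1 / 2) ltac:(rewrite Rabs_pos_eq; lra) e He) as [N HN].
  specialize (HN N (Nat.le_refl N)). fold (r N) in HN.
  rewrite Rabs_pos_eq in HN by (apply Rlt_le, Hr).
  destruct (Hu N) as [B1 [B2 B3]]. apply B3.
  specialize (Hx N). specialize (Hy N). simpl in Hx, Hy. fold W H in K.
  apply K; [split; [apply Hr|exact HN]|lra..].
Qed.

(** * Goursat's theorem on a closed parallelogram *)

Definition box_all (w1 w2 : C) (s1 s2 t1 t2 : R) (P : C -> Prop) : Prop :=
  forall s t, s1 <= s <= s2 -> t1 <= t <= t2 -> P (pt w1 w2 s t).

Lemma box_bd (w1 w2 : C) (s1 s2 t1 t2 : R) (P : C -> Prop) :
  box_all w1 w2 s1 s2 t1 t2 P -> bd_all w1 w2 s1 s2 t1 t2 P.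
Proof. intros H s t [Hs [Ht _]]. auto. Qed.

Lemma box_sub (w1 w2 : C) (s1 s2 t1 t2 a b c d : R) (P : C -> Prop) :
  s1 <= a -> b <= s2 -> t1 <= c -> d <= t2 ->
  box_all w1 w2 s1 s2 t1 t2 P -> box_all w1 w2 a b c d P.
Proof. intros ? ? ? ? H s t Hs Ht. apply H; lra. Qed.

Lemma box_impl (w1 w2 : C) (s1 s2 t1 t2 : R) (P Q : C -> Prop) :
  (forall z, P z -> Q z) ->
  box_all w1 w2 s1 s2 t1 t2 P -> box_all w1 w2 s1 s2 t1 t2 Q.
Proof. intros H K s t Hs Ht. auto. Qed.

Lemma pt_minus (w1 w2 : C) (s t x y : R) :
  (pt w1 w2 s t - pt w1 w2 x y)%C = pt w1 w2 (s - x) (t - y).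
Proof. unfold pt. rewrite !RtoC_minus. ring. Qed.

Lemma Cmod_pt_le (w1 w2 : C) (s t : R) :
  Cmod (pt w1 w2 s t) <= Rabs s * Cmod w1 + Rabs t * Cmod w2.
Proof.
  unfold pt. eapply Rle_trans; [apply Cmod_triangle|].
  rewrite !Cmod_mult, !Cmod_R. lra.
Qed.

(** The bound by [e] times the area is stable under cutting, as integrals over the common edge
    cancel and areas add up. On a box of scale [r] near [p], the remainder of the affine
    approximation is at most a small multiple of [r] and the perimeter is a multiple of [r]. The
    integral is thus a small multiple of [r * r], that is, of the area. *)
Lemma goursat (w1 w2 : C) (F : C -> C) (s1 s2 t1 t2 : R) :
  s1 < s2 -> t1 < t2 -> box_all w1 w2 s1 s2 t1 t2 (Cdifferentiable F) ->
  bd_integral w1 w2 F s1 s2 t1 t2 = RtoC 0.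
Proof.
  intros Hs Ht HF.
  assert (CF : box_all w1 w2 s1 s2 t1 t2 (Ccontinuous_at F)).
  { revert HF. apply box_impl. intros z. apply Cdifferentiable_continuous. }
  assert (small : forall e, 0 < e ->
    Cmod (bd_integral w1 w2 F s1 s2 t1 t2) <= e * ((s2 - s1) * (t2 - t1))).
  { intros e He.
    apply (box_induction (fun a b c d =>
      Cmod (bd_integral w1 w2 F a b c d) <= e * ((b - a) * (d - c)))); try assumption.
    - intros a m b c d H1 H2 H3 H4 Q1 Q2.
      rewrite (bd_integral_split_s w1 w2 F a m b); try lra.
      + eapply Rle_trans; [apply Cmod_triangle|]. lra.
      + apply box_bd. revert CF. apply box_sub; lra.
    - intros a b c m d H1 H2 H3 H4 Q1 Q2.
      rewrite (bd_integral_split_t w1 w2 F a b c m d); try lra.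
      + eapply Rle_trans; [apply Cmod_triangle|]. lra.
      + apply box_bd. revert CF. apply box_sub; lra.
    - intros x y Hx Hy. set (W := s2 - s1). set (H := t2 - t1).
      set (p := pt w1 w2 x y). destruct (HF x y Hx Hy) as [D HD]. fold p in HD.
      set (L := W * Cmod w1 + H * Cmod w2).
      assert (HW : 0 < W) by (unfold W; lra). assert (HH : 0 < H) by (unfold H; lra).
      assert (L0 : 0 <= L).
      { unfold L. pose proof (Cmod_ge_0 w1). pose proof (Cmod_ge_0 w2). nra. }
      (* Chosen so that [4 * e' * (L + 1) * (L + 1)] equals [e * (W * H)]. Here [L + 1] guards
         against [L = 0], since [w1] and [w2] are arbitrary in this lemma. *)
      set (e' := e * (W * H) / (4 * ((L + 1) * (L + 1)))).
      assert (He' : 0 < e').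
      { unfold e'. apply Rdiv_lt_0_compat; repeat apply Rmult_lt_0_compat; lra. }
      destruct (HD e' He') as [d [Hd K]].
      exists (d / (L + 1)). split; [apply Rdiv_lt_0_compat; lra|].
      intros r a c Hr Ha Hb Hc Hd'.
      replace (a + r * W - a) with (r * W) by ring.
      replace (c + r * H - c) with (r * H) by ring.
      assert (rd : r * (L + 1) < d) by (apply Rlt_div_r; lra).
      assert (rW : 0 < r * W) by (apply Rmult_lt_0_compat; lra).
      assert (rH : 0 < r * H) by (apply Rmult_lt_0_compat; lra).
      assert (CF' : box_all w1 w2 a (a + r * W) c (c + r * H) (Ccontinuous_at F)).
      { revert CF. apply box_sub; lra. }
      (* [A + D * z] is the tangent affine function at [p], and [G] is [F] minus it, hence at most
         [e' * Cmod (z - p)] near [p]. *)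
      set (A := (F p - D * p)%C).
      set (G := fun z => (F z + (- A + - D * z))%C).
      assert (CA : forall z, Ccontinuous_at (fun z => - A + - D * z)%C z).
      { intros z. apply Ccontinuous_plus; [apply Ccontinuous_const|].
        apply Ccontinuous_mult; [apply Ccontinuous_const|apply Ccontinuous_id]. }
      assert (E : bd_integral w1 w2 F a (a + r * W) c (c + r * H) =
        bd_integral w1 w2 G a (a + r * W) c (c + r * H)).
      { unfold G. rewrite bd_integral_plus; try lra.
        - rewrite bd_integral_affine by lra. ring.
        - apply box_bd, CF'.
        - intros s t _. apply CA. }
      rewrite E. eapply Rle_trans.
      { apply (bd_integral_bound _ _ _ (e' * (r * L))); try lra.
        - intros s t Hst. apply Ccontinuous_plus; [|apply CA]. apply box_bd in CF'. auto.
        - intros s t [Hs' [Ht' _]].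
          assert (B : Cmod (pt w1 w2 s t - p) <= r * L).
          { unfold p. rewrite pt_minus. eapply Rle_trans; [apply Cmod_pt_le|].
            assert (Rabs (s - x) <= r * W) by (apply Rabs_le; lra).
            assert (Rabs (t - y) <= r * H) by (apply Rabs_le; lra).
            pose proof (Cmod_ge_0 w1). pose proof (Cmod_ge_0 w2).
            unfold L. nra. }
          unfold G, A.
          replace (F (pt w1 w2 s t) + (- (F p - D * p) + - D * pt w1 w2 s t))%C
            with (F (pt w1 w2 s t) - F p - D * (pt w1 w2 s t - p))%C by ring.
          eapply Rle_trans; [apply K; nra|].
          apply Rmult_le_compat_l; lra. }
      replace (Cmod w1 * (a + r * W - a) + Cmod w2 * (c + r * H - c))
        with (r * L) by (unfold L; ring).
      replace (4 * (e' * (r * L)) * (r * L)) with ((r * r) * (4 * e' * (L * L))) by ring.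
      replace (e * (r * W * (r * H))) with ((r * r) * (e * (W * H))) by ring.
      apply Rmult_le_compat_l; [nra|].
      apply Rle_trans with (4 * e' * ((L + 1) * (L + 1))).
      { apply Rmult_le_compat_l; [lra|]. apply Rmult_le_compat; lra. }
      unfold e'. right. field. lra. }
  apply Cmod_eq_0. apply Rle_antisym; [|apply Cmod_ge_0].
  apply le_epsilon. intros e He.
  assert (A : 0 < (s2 - s1) * (t2 - t1)) by (apply Rmult_lt_0_compat; lra).
  eapply Rle_trans; [apply (small (e / ((s2 - s1) * (t2 - t1))))|].
  - apply Rdiv_lt_0_compat; assumption.
  - right. field. lra.
Qed.

(** The determinant of [z] and [w] as real vectors, equal to the imaginary part of [Cconj z * w]. It
    is nonzero exactly when they form a real basis of the plane, and its sign is their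
    orientation. *)
Definition cross (z w : C) : R := fst z * snd w - snd z * fst w.

Lemma Rabs_cross_le (z w : C) : Rabs (cross z w) <= Cmod z * Cmod w.
Proof.
  rewrite <- (Cmod_conj z), <- Cmod_mult.
  eapply Rle_trans; [|apply Rmax_Cmod]. eapply Rle_trans; [|apply Rmax_r].
  unfold cross; simpl. right. f_equal. ring.
Qed.

Lemma cross_pt_l (w1 w2 : C) (s t : R) : cross (pt w1 w2 s t) w2 = s * cross w1 w2.
Proof. unfold cross, pt; simpl. ring. Qed.

Lemma cross_pt_r (w1 w2 : C) (s t : R) : cross w1 (pt w1 w2 s t) = t * cross w1 w2.
Proof. unfold cross, pt; simpl. ring. Qed.

(** Cramer's rule. *)
Lemma pt_coordinates (w1 w2 z : C) :
  cross w1 w2 <> 0 -> exists s t, z = pt w1 w2 s t.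
Proof.
  intros D. exists (cross z w2 / cross w1 w2), (cross w1 z / cross w1 w2).
  unfold cross in *. apply injective_projections; unfold pt; simpl; field; exact D.
Qed.

(** Pairing [pt w1 w2 s t] with [w2] or [w1] by [cross] isolates one coordinate, and [Rabs_cross_le]
    bounds the result. With the converse estimate [Cmod_pt_le], discs and coordinate boxes become
    interchangeable. *)
Lemma Cmod_pt_ge (w1 w2 : C) :
  cross w1 w2 <> 0 ->
  exists k, 0 < k /\ forall s t, k * Rabs s <= Cmod (pt w1 w2 s t) /\
    k * Rabs t <= Cmod (pt w1 w2 s t).
Proof.
  intros D. pose proof (Cmod_ge_0 w1) as P1. pose proof (Cmod_ge_0 w2) as P2.
  apply Rabs_pos_lt in D. set (M := Cmod w1 + Cmod w2 + 1).
  assert (HM : 0 < M) by (unfold M; lra).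
  exists (Rabs (cross w1 w2) / M). split; [apply Rdiv_lt_0_compat; lra|].
  intros s t. pose proof (Cmod_ge_0 (pt w1 w2 s t)).
  pose proof (Rabs_cross_le (pt w1 w2 s t) w2) as A.
  rewrite cross_pt_l, Rabs_mult in A.
  pose proof (Rabs_cross_le w1 (pt w1 w2 s t)) as B.
  rewrite cross_pt_r, Rabs_mult in B.
  split.
  - replace (Rabs (cross w1 w2) / M * Rabs s)
      with ((Rabs s * Rabs (cross w1 w2)) / M) by (field; lra).
    apply Rle_div_l; [lra|]. unfold M. nra.
  - replace (Rabs (cross w1 w2) / M * Rabs t)
      with ((Rabs t * Rabs (cross w1 w2)) / M) by (field; lra).
    apply Rle_div_l; [lra|]. unfold M. nra.
Qed.

Lemma pt_inj (w1 w2 : C) (s t x y : R) :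
  cross w1 w2 <> 0 -> pt w1 w2 s t = pt w1 w2 x y -> s = x /\ t = y.
Proof.
  intros D E. split; apply Rmult_eq_reg_r with (cross w1 w2); try exact D.
  - rewrite <- !(cross_pt_l w1 w2 _ t), E, !cross_pt_l. reflexivity.
  - rewrite <- !(cross_pt_r w1 w2 s), E, !cross_pt_r. reflexivity.
Qed.

(** * Winding and Cauchy's formula *)

Lemma CRInt_shift (F : R -> C) (c a b : R) :
  a <= b -> RCcontinuous_on F (a + c) (b + c) -> CRInt F (a + c) (b + c) = CRInt
    (fun s => F (s + c)) a b.
Proof.
  intros Hab H. destruct (RCcontinuous_on_ex_RInt F (a + c) (b + c) ltac:(lra) H) as [H1 H2].
  assert (K : forall f : R -> R, ex_RInt f (a + c) (b + c) ->
    RInt f (a + c) (b + c) = RInt (fun s => f (s + c)) a b).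
  { intros f Hf.
    replace (a + c) with (1 * a + c) in * by ring.
    replace (b + c) with (1 * b + c) in * by ring.
    rewrite <- (RInt_comp_lin f 1 c a b Hf). apply RInt_ext. intros s _.
    unfold scal; simpl; unfold mult; simpl. rewrite !Rmult_1_l. reflexivity. }
  unfold CRInt. f_equal; [apply (K (fun s => fst (F s)))|apply (K (fun s => snd (F s)))];
    assumption.
Qed.


Lemma edge_integral_translate (F : C -> C) (w u q v : C) (c a b : R) :
  a <= b -> Ccontinuous_on F w u a b -> (RtoC c * w + v - q)%C = u ->
  edge_integral (fun z => F (z - q))%C w v (a + c) (b + c) = edge_integral F w u a b.
Proof.
  intros Hab H E. unfold edge_integral. f_equal. rewrite CRInt_shift; [|exact Hab|].
  - apply CRInt_ext; [exact Hab|]. intros s _. f_equal. rewrite <- E, RtoC_plus. ring.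
  - intros s Hs. specialize (H (s - c) ltac:(lra)). 
    apply (Ccontinuous_RC (fun z => F (z - q))%C w v s).
    replace (RtoC (s - c) * w + u)%C with (RtoC s * w + v - q)%C in H
      by (rewrite <- E, RtoC_minus; ring).
    intros e He. destruct (H e He) as [d [Hd K]]. exists d. split; [exact Hd|].
    intros z Hz. apply K.
    replace (z - q - (RtoC s * w + v - q))%C with (z - (RtoC s * w + v))%C by ring.
    exact Hz.
Qed.

Section Cauchy.

Variables w1 w2 : C.
Hypothesis D : cross w1 w2 <> 0.

Lemma bd_integral_translate (F : C -> C) (x y s1 s2 t1 t2 : R) :
  s1 <= s2 -> t1 <= t2 -> bd_all w1 w2 s1 s2 t1 t2 (Ccontinuous_at F) ->
  bd_integral w1 w2 (fun z => F (z - pt w1 w2 x y))%C (s1 + x) (s2 + x) (t1 + y) (t2 + y) =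
  bd_integral w1 w2 F s1 s2 t1 t2.
Proof.
  intros Hs Ht H.
  destruct (bd_all_edges _ _ _ _ _ _ _ Hs Ht H) as [F1 [F2 [F3 F4]]].
  unfold bd_integral, pt.
  rewrite (edge_integral_translate F w1 (RtoC t1 * w2) _ (RtoC (t1 + y) * w2))
    by (try assumption; rewrite RtoC_plus; ring).
  rewrite (edge_integral_translate F w1 (RtoC t2 * w2) _ (RtoC (t2 + y) * w2))
    by (try assumption; rewrite RtoC_plus; ring).
  rewrite (edge_integral_translate F w2 (RtoC s1 * w1) _ (RtoC (s1 + x) * w1))
    by (try assumption; rewrite RtoC_plus; ring).
  rewrite (edge_integral_translate F w2 (RtoC s2 * w1) _ (RtoC (s2 + x) * w1))
    by (try assumption; rewrite RtoC_plus; ring).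
  reflexivity.
Qed.

(** Four cuts separate the small box from the strips to its left, to its right, below and above.
    None of the strips contains the exceptional point, so Goursat's theorem removes their
    integrals. *)
Lemma bd_integral_shrink (F : C -> C) (s1 s2 t1 t2 x y e : R) :
  0 < e -> s1 < x - e -> x + e < s2 -> t1 < y - e -> y + e < t2 ->
  box_all w1 w2 s1 s2 t1 t2 (fun z => z <> pt w1 w2 x y -> Cdifferentiable F z) ->
  bd_integral w1 w2 F s1 s2 t1 t2 = bd_integral w1 w2 F (x - e) (x + e) (y - e) (y + e).
Proof.
  intros He H1 H2 H3 H4 H.
  assert (K : forall s t, s1 <= s <= s2 -> t1 <= t <= t2 -> (s <> x \/ t <> y) ->
    Cdifferentiable F (pt w1 w2 s t)).
  { intros s t Hs Ht N. apply H; try assumption. intros E.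
    apply pt_inj in E; [lra|exact D]. }
  assert (KC : forall s t, s1 <= s <= s2 -> t1 <= t <= t2 -> (s <> x \/ t <> y) ->
    Ccontinuous_at F (pt w1 w2 s t)).
  { intros s t Hs Ht N. apply Cdifferentiable_continuous. auto. }
  rewrite (bd_integral_split_s w1 w2 F s1 (x - e) s2) by
    (try lra; intros s t [Hs [Ht Hb]]; apply KC; lra).
  rewrite (bd_integral_split_s w1 w2 F (x - e) (x + e) s2) by
    (try lra; intros s t [Hs [Ht Hb]]; apply KC; lra).
  rewrite (bd_integral_split_t w1 w2 F (x - e) (x + e) t1 (y - e) t2) by
    (try lra; intros s t [Hs [Ht Hb]]; apply KC; lra).
  rewrite (bd_integral_split_t w1 w2 F (x - e) (x + e) (y - e) (y + e) t2) by
    (try lra; intros s t [Hs [Ht Hb]]; apply KC; lra).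
  rewrite (goursat w1 w2 F s1 (x - e) t1 t2) by
    (try lra; intros s t Hs Ht; apply K; lra).
  rewrite (goursat w1 w2 F (x + e) s2 t1 t2) by
    (try lra; intros s t Hs Ht; apply K; lra).
  rewrite (goursat w1 w2 F (x - e) (x + e) t1 (y - e)) by
    (try lra; intros s t Hs Ht; apply K; lra).
  rewrite (goursat w1 w2 F (x - e) (x + e) (y + e) t2) by
    (try lra; intros s t Hs Ht; apply K; lra).
  ring.
Qed.

Lemma Cdifferentiable_inv_translate (q z : C) : z <> q -> Cdifferentiable
  (fun z => / (z - q))%C z.
Proof.
  intros N. apply Cdifferentiable_ext with (fun z => RtoC 1 / (z - q))%C.
  - apply near_all. intros u. unfold Cdiv. ring.
  - apply Cdifferentiable_div; [|apply Cdifferentiable_const|apply Cdifferentiable_translate].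
    intros E. apply N, Ceq_minus, E.
Qed.

(* Plays the role of [2 * PI * Ci]; only [winding_const <> 0] matters. *)
Definition winding_const : C := bd_integral w1 w2 Cinv (-1) 1 (-1) 1.

Lemma small_square (s1 s2 t1 t2 x y h : R) :
  s1 < x < s2 -> t1 < y < t2 -> 0 < h ->
  exists e, 0 < e < h /\ s1 < x - e /\ x + e < s2 /\ t1 < y - e /\ y + e < t2.
Proof.
  intros Hx Hy Hh.
  set (m := Rmin (Rmin (x - s1) (s2 - x)) (Rmin (Rmin (y - t1) (t2 - y)) h)).
  assert (Hm : 0 < m) by (unfold m; repeat apply Rmin_pos; lra).
  assert (m <= x - s1 /\ m <= s2 - x /\ m <= y - t1 /\ m <= t2 - y /\ m <= h)
    as (A1 & A2 & A3 & A4 & A5).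
  { unfold m. repeat split; repeat first
      [ apply Rle_refl
      | eapply Rle_trans; [apply Rmin_l|]; solve [repeat first
          [apply Rle_refl | eapply Rle_trans; [apply Rmin_l|]; apply Rle_refl
          | eapply Rle_trans; [apply Rmin_r|]; apply Rle_refl]]
      | eapply Rle_trans; [apply Rmin_r|] ]. }
  exists (m / 2). lra.
Qed.

(** Both this integral and [winding_const] shrink to boxes of the same half-side [e] around their
    singular points, and these two boxes are translates of each other. *)
Lemma winding (s1 s2 t1 t2 x y : R) :
  s1 < x < s2 -> t1 < y < t2 ->
  bd_integral w1 w2 (fun z => / (z - pt w1 w2 x y))%C s1 s2 t1 t2 = winding_const.
Proof.
  intros Hx Hy. destruct (small_square s1 s2 t1 t2 x y 1) as [e He]; try lra.
  rewrite (bd_integral_shrink _ _ _ _ _ x y e) by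
    (try lra; intros s t _ _ N; apply Cdifferentiable_inv_translate, N).
  assert (Z : pt w1 w2 0 0 = RtoC 0) by (unfold pt; ring).
  assert (I : forall z, z <> RtoC 0 -> Cdifferentiable Cinv z).
  { intros z Hz. apply Cdifferentiable_ext with (fun z => / (z - RtoC 0))%C.
    - apply near_all. intros u. f_equal. ring.
    - apply Cdifferentiable_inv_translate, Hz. }
  unfold winding_const. rewrite (bd_integral_shrink Cinv (-1) 1 (-1) 1 0 0 e) by
    (try lra; intros s t _ _ N; apply I; rewrite <- Z; exact N).
  rewrite <- (bd_integral_translate Cinv x y).
  - f_equal; ring.
  - lra.
  - lra.
  - intros s t [Hs [Ht Hb]]. apply Cdifferentiable_continuous, I. rewrite <- Z. intros E.
    apply pt_inj in E; [lra|exact D].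
Qed.

(** With [v] the point on the edge, the imaginary part of [w / v] is [cross v w] divided by the
    squared modulus of [v]. The numerator is constant along the edge, equal to [cross u w], since
    [v - u] is a multiple of [w]. *)
Lemma edge_integral_inv_Im (w u : C) (a b : R) :
  a < b -> cross u w <> 0 ->
  exists k, 0 < k /\ snd (edge_integral Cinv w u a b) = cross u w * k.
Proof.
  intros Hab Huw.
  set (v := fun s => (RtoC s * w + u)%C).
  set (n := fun s => fst (v s) ^ 2 + snd (v s) ^ 2).
  assert (Nv : forall s, v s <> RtoC 0).
  { intros s E. apply Huw. replace (cross u w) with (cross (v s) w).
    - rewrite E. unfold cross; simpl. ring.
    - unfold cross, v; simpl. ring. }
  assert (Nn : forall s, 0 < n s).
  { intros s. unfold n.
    pose proof (pow2_ge_0 (fst (v s))). pose proof (pow2_ge_0 (snd (v s))).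
    destruct (Req_dec (fst (v s)) 0) as [E1|E1]; destruct (Req_dec (snd (v s)) 0) as [E2|E2].
    - exfalso. apply (Nv s). apply injective_projections; simpl; assumption.
    - pose proof (pow2_gt_0 _ E2). lra.
    - pose proof (pow2_gt_0 _ E1). lra.
    - pose proof (pow2_gt_0 _ E1). lra. }
  assert (Cn : forall s, continuous (fun s => / n s) s).
  { intros s. apply (ex_derive_continuous (fun s => / n s)).
    unfold n, v; simpl. auto_derive. specialize (Nn s). unfold n, v in Nn.
    simpl in Nn. lra. }
  exists (RInt (fun s => / n s) a b). split.
  - apply RInt_gt_0; [exact Hab| |].
    + intros s _. apply Rinv_0_lt_compat, Nn.
    + intros s _. apply Cn.
  - unfold edge_integral. rewrite <- CRInt_scal.
    + unfold CRInt; simpl. rewrite <- (RInt_scal (V := R_CompleteNormedModule)).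
      * apply RInt_ext. intros s _. unfold scal; simpl; unfold mult; simpl.
        specialize (Nn s). unfold n, v, cross in *; simpl in *. field. lra.
      * apply (ex_RInt_continuous (V := R_CompleteNormedModule)). intros s _. apply Cn.
    + lra.
    + intros s _. apply Ccontinuous_RC. apply Ccontinuous_inv; [apply Nv|apply Ccontinuous_id].
Qed.

(** Taken with the sign of its direction, each of the four edges contributes a positive multiple of
    [cross w1 w2] to the imaginary part. *)
Lemma winding_const_neq_0 : winding_const <> RtoC 0.
Proof.
  intros E. apply (f_equal snd) in E. unfold winding_const, bd_integral in E.
  unfold cross in D.
  destruct (edge_integral_inv_Im w1 (RtoC (-1) * w2) (-1) 1) as [k1 [P1 E1]];
    [lra|unfold cross; simpl; lra|].
  destruct (edge_integral_inv_Im w2 (RtoC 1 * w1) (-1) 1) as [k2 [P2 E2]];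
    [lra|unfold cross; simpl; lra|].
  destruct (edge_integral_inv_Im w1 (RtoC 1 * w2) (-1) 1) as [k3 [P3 E3]];
    [lra|unfold cross; simpl; lra|].
  destruct (edge_integral_inv_Im w2 (RtoC (-1) * w1) (-1) 1) as [k4 [P4 E4]];
    [lra|unfold cross; simpl; lra|].
  unfold Cminus, Cplus, Copp, RtoC in E, E1, E2, E3, E4.
  cbn [fst snd] in E. rewrite E1, E2, E3, E4 in E.
  unfold cross in E; cbn [fst snd Cmult] in E.
  assert (F : (k1 + k2 + k3 + k4) * (fst w1 * snd w2 - snd w1 * fst w2) = 0) by lra.
  apply Rmult_integral in F. destruct F; [lra|contradiction].
Qed.

(** [g z / (z - q)] is the difference quotient [G] plus [g q / (z - q)]. The second part gives the
    winding constant. The quotient is bounded near [q] because [g] is differentiable there, so its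
    integral over a shrinking box around [q] tends to [0]. *)
Lemma cauchy_formula (g : C -> C) (s1 s2 t1 t2 x y : R) :
  s1 < x < s2 -> t1 < y < t2 -> box_all w1 w2 s1 s2 t1 t2 (Cdifferentiable g) ->
  bd_integral w1 w2 (fun z => g z / (z - pt w1 w2 x y))%C s1 s2 t1 t2 =
    (winding_const * g (pt w1 w2 x y))%C.
Proof.
  intros Hx Hy Hg. set (q := pt w1 w2 x y).
  set (G := fun z => ((g z - g q) / (z - q))%C).
  assert (GD : box_all w1 w2 s1 s2 t1 t2 (fun z => z <> q -> Cdifferentiable G z)).
  { intros s t Hs Ht N. apply Cdifferentiable_div.
    - intros E. apply N, Ceq_minus, E.
    - apply Cdifferentiable_minus; [apply Hg; assumption|apply Cdifferentiable_const].
    - apply Cdifferentiable_translate. }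
  assert (OFF : forall a b c d s t, a < x < b -> c < y < d -> on_bd a b c d s t ->
    pt w1 w2 s t <> q).
  { intros a b c d s t Ha Hc [Hs [Ht Hb]] E. apply pt_inj in E; [lra|exact D]. }
  assert (Z : bd_integral w1 w2 G s1 s2 t1 t2 = RtoC 0).
  { destruct (Hg x y ltac:(lra) ltac:(lra)) as [d Hd]. fold q in Hd.
    destruct (Hd 1 ltac:(lra)) as [h [Hh K]].
    set (L := Cmod w1 + Cmod w2).
    assert (HL : 0 <= L)
      by (unfold L; pose proof (Cmod_ge_0 w1); pose proof (Cmod_ge_0 w2); lra).
    pose proof (Cmod_ge_0 d) as Pd.
    apply Cmod_eq_0, Rle_antisym; [|apply Cmod_ge_0].
    apply le_epsilon. intros eps He.
    (* The first bound keeps the box in the disc where [Cmod (G z) <= Cmod d + 1]. The second makes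
       [4 * (Cmod d + 1) * (2 * e * L)], the resulting bound for the integral, smaller than
       [eps]. *)
    destruct (small_square s1 s2 t1 t2 x y
      (Rmin (h / (L + 1)) (eps / (8 * (Cmod d + 1) * (L + 1))))) as [e [He' HB]];
      try assumption.
    { apply Rmin_pos; apply Rdiv_lt_0_compat; try lra.
      repeat apply Rmult_lt_0_compat; lra. }
    assert (e1 : e * (L + 1) < h).
    { apply Rlt_div_r; [lra|]. eapply Rlt_le_trans; [apply He'|apply Rmin_l]. }
    assert (e2 : e * (8 * (Cmod d + 1) * (L + 1)) < eps).
    { apply Rlt_div_r; [repeat apply Rmult_lt_0_compat; lra|].
      eapply Rlt_le_trans; [apply He'|apply Rmin_r]. }
    rewrite (bd_integral_shrink G s1 s2 t1 t2 x y e) by (try lra; exact GD).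
    eapply Rle_trans; [apply (bd_integral_bound _ _ _ (Cmod d + 1)); try lra|].
    - intros s t Hst. apply Cdifferentiable_continuous. apply GD; try (destruct Hst; lra).
      eapply OFF; [| |exact Hst]; lra.
    - intros s t Hst. pose proof (OFF (x - e) (x + e) (y - e) (y + e) s t ltac:(lra) ltac:(lra) Hst) as N.
      destruct Hst as [Hs [Ht _]].
      assert (N' : (pt w1 w2 s t - q)%C <> RtoC 0) by (intros E; apply N, Ceq_minus, E).
      apply Cmod_gt_0 in N' as N''.
      unfold G. rewrite Cmod_div by exact N'. apply Rle_div_l; [exact N''|].
      replace (g (pt w1 w2 s t) - g q)%C with
        ((g (pt w1 w2 s t) - g q - d * (pt w1 w2 s t - q)) + d * (pt w1 w2 s t - q))%C
        by ring.
      eapply Rle_trans; [apply Cmod_triangle|]. rewrite Cmod_mult.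
      assert (Cmod (pt w1 w2 s t - q) < h).
      { unfold q. rewrite pt_minus. eapply Rle_lt_trans; [apply Cmod_pt_le|].
        assert (Rabs (s - x) <= e) by (apply Rabs_le; lra).
        assert (Rabs (t - y) <= e) by (apply Rabs_le; lra).
        pose proof (Cmod_ge_0 w1). pose proof (Cmod_ge_0 w2). unfold L in *. nra. }
      specialize (K (pt w1 w2 s t) H). lra.
    - replace (Cmod w1 * (x + e - (x - e)) + Cmod w2 * (y + e - (y - e)))
        with (2 * e * L) by (unfold L; ring).
      nra. }
  rewrite (bd_integral_ext w1 w2 _ (fun z => G z + g q * / (z - q))%C); try lra.
  - rewrite bd_integral_plus; try lra.
    + rewrite bd_integral_scal; try lra.
      * unfold q at 2. rewrite winding by assumption. rewrite Z. ring.
      * intros s t Hst. apply Cdifferentiable_continuous, Cdifferentiable_inv_translate.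
        eapply OFF; eassumption.
    + intros s t Hst. apply Cdifferentiable_continuous. apply GD; try apply Hst.
      eapply OFF; eassumption.
    + intros s t Hst. apply Ccontinuous_mult; [apply Ccontinuous_const|].
      apply Cdifferentiable_continuous, Cdifferentiable_inv_translate. eapply OFF; eassumption.
  - intros s t Hst. unfold G. field. intros E.
    apply (OFF _ _ _ _ _ _ Hx Hy Hst), Ceq_minus, E.
Qed.

End Cauchy.

(** * Local structure of holomorphic functions *)

Section Local_structure.

Variables w1 w2 : C.
Hypothesis D : cross w1 w2 <> 0.
Let winding_const := winding_const w1 w2.
Let winding_const_neq_0 : winding_const <> RtoC 0 := winding_const_neq_0 w1 w2 D.

(** * Discs against coordinate boxes, and compactness by bisection *)

Lemma bd_dist (s1 s2 t1 t2 x y : R) :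
  s1 < x < s2 -> t1 < y < t2 ->
  exists d, 0 < d /\ bd_all w1 w2 s1 s2 t1 t2 (fun z => d <= Cmod (z - pt w1 w2 x y)).
Proof.
  intros Hx Hy. destruct (Cmod_pt_ge w1 w2 D) as [k [Hk K]].
  destruct (small_square s1 s2 t1 t2 x y 1 Hx Hy ltac:(lra)) as [e [He HB]].
  exists (k * e). split; [nra|]. intros s t [Hs [Ht Hb]]. rewrite pt_minus.
  destruct (K (s - x) (t - y)) as [A1 A2].
  assert (B : e <= Rabs (s - x) \/ e <= Rabs (t - y)).
  { destruct Hb as [E|[E|[E|E]]]; [left|left|right|right]; subst;
      unfold Rabs; destruct Rcase_abs; lra. }
  destruct B; nra.
Qed.

Lemma near_box (x y : R) (P : C -> Prop) :
  near (pt w1 w2 x y) P ->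
  exists e, 0 < e /\ box_all w1 w2 (x - e) (x + e) (y - e) (y + e) P.
Proof.
  intros [d [Hd H]]. set (L := Cmod w1 + Cmod w2 + 1).
  pose proof (Cmod_ge_0 w1). pose proof (Cmod_ge_0 w2).
  assert (HL : 0 < L) by (unfold L; lra).
  exists (d / L). split; [apply Rdiv_lt_0_compat; lra|].
  intros s t Hs Ht. apply H. rewrite pt_minus.
  eapply Rle_lt_trans; [apply Cmod_pt_le|].
  assert (Rabs (s - x) <= d / L) by (apply Rabs_le; lra).
  assert (Rabs (t - y) <= d / L) by (apply Rabs_le; lra).
  assert (d / L * L = d) by (field; lra).
  assert (0 < d / L) by (apply Rdiv_lt_0_compat; lra).
  unfold L in *. nra.
Qed.

Lemma near_interior (s1 s2 t1 t2 x y : R) :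
  s1 < x < s2 -> t1 < y < t2 ->
  near (pt w1 w2 x y) (fun z => exists s t, z = pt w1 w2 s t /\ s1 < s < s2 /\ t1 < t < t2).
Proof.
  intros Hx Hy. destruct (Cmod_pt_ge w1 w2 D) as [k [Hk K]].
  destruct (small_square s1 s2 t1 t2 x y 1 Hx Hy ltac:(lra)) as [e [He HB]].
  exists (k * e). split; [nra|]. intros z Hz.
  destruct (pt_coordinates w1 w2 z D) as [s [t E]]. exists s, t.
  split; [exact E|]. subst z. rewrite pt_minus in Hz.
  destruct (K (s - x) (t - y)) as [A1 A2].
  assert (B1 : Rabs (s - x) < e) by nra. assert (B2 : Rabs (t - y) < e) by nra.
  apply Rabs_def2 in B1. apply Rabs_def2 in B2. lra.
Qed.

(** Serves the purely topological arguments: boundedness, the identity theorem and finiteness. A box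
    with sides [r * W] and [r * H] containing the point stays within [e] of it in each coordinate
    once [r < e / (W + H)]. *)
Lemma box_induction_near (Q : R -> R -> R -> R -> Prop) (s1 s2 t1 t2 : R) :
  s1 < s2 -> t1 < t2 ->
  (forall a m b c d, a < m < b -> c < d -> Q a m c d -> Q m b c d -> Q a b c d) ->
  (forall a b c m d, a < b -> c < m < d -> Q a b c m -> Q a b m d -> Q a b c d) ->
  (forall x y, s1 <= x <= s2 -> t1 <= y <= t2 ->
    exists P, near (pt w1 w2 x y) P /\ forall a b c d, box_all w1 w2 a b c d P -> Q a b c d) ->
  Q s1 s2 t1 t2.
Proof.
  intros Hs Ht addS addT loc. apply box_induction; try assumption.
  - intros a m b c d H1 H2 H3 H4. apply addS; lra.
  - intros a b c m d H1 H2 H3 H4. apply addT; lra.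
  - intros x y Hx Hy. destruct (loc x y Hx Hy) as [P [NP K]].
    destruct (near_box x y P NP) as [e [He B]].
    set (W := s2 - s1). set (H := t2 - t1).
    assert (0 < W) by (unfold W; lra). assert (0 < H) by (unfold H; lra).
    exists (e / (W + H)). split; [apply Rdiv_lt_0_compat; lra|].
    intros r a c Hr Ha Hb Hc Hd.
    assert (R : r * (W + H) < e) by (apply Rlt_div_r; lra).
    apply K. revert B. apply box_sub; nra.
Qed.

Lemma box_bounded (F : C -> C) (s1 s2 t1 t2 : R) :
  s1 < s2 -> t1 < t2 -> box_all w1 w2 s1 s2 t1 t2 (Ccontinuous_at F) ->
  exists M, 0 < M /\ box_all w1 w2 s1 s2 t1 t2 (fun z => Cmod (F z) <= M).
Proof.
  intros Hs Ht HF.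
  apply (box_induction_near (fun a b c d =>
    exists M, 0 < M /\ box_all w1 w2 a b c d (fun z => Cmod (F z) <= M)));
    try assumption.
  - intros a m b c d _ _ [M [HM B]] [N [HN B']]. exists (M + N).
    split; [lra|]. intros s t Hs' Ht'. destruct (Rle_dec s m).
    + specialize (B s t ltac:(lra) Ht'). lra.
    + specialize (B' s t ltac:(lra) Ht'). lra.
  - intros a b c m d _ _ [M [HM B]] [N [HN B']]. exists (M + N).
    split; [lra|]. intros s t Hs' Ht'. destruct (Rle_dec t m).
    + specialize (B s t Hs' ltac:(lra)). lra.
    + specialize (B' s t Hs' ltac:(lra)). lra.
  - intros x y Hx Hy. eexists. split; [apply Ccontinuous_bounded, HF; assumption|].
    intros a b c d K. exists (Cmod (F (pt w1 w2 x y)) + 1).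
    split; [pose proof (Cmod_ge_0 (F (pt w1 w2 x y))); lra|exact K].
Qed.

(** Differentiation under the integral sign: a remainder that is quadratic in [q - q0], uniformly on
    the contour, stays quadratic after integration. It is written with sums and scalar factors only,
    so that [bd_integral_plus] and [bd_integral_scal] apply. *)
Lemma bd_integral_param_derive (Phi : C -> C -> C) (Psi : C -> C) (q0 : C) (M s1 s2 t1 t2 : R) :
  s1 <= s2 -> t1 <= t2 -> 0 <= M ->
  near q0 (fun q => bd_all w1 w2 s1 s2 t1 t2 (Ccontinuous_at (Phi q))) ->
  bd_all w1 w2 s1 s2 t1 t2 (Ccontinuous_at Psi) ->
  near q0 (fun q => bd_all w1 w2 s1 s2 t1 t2 (fun z =>
    Cmod (Phi q z + (RtoC (-1) * Phi q0 z + - (q - q0) * Psi z))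
    <= M * (Cmod (q - q0) * Cmod (q - q0)))) ->
  is_Cderive (fun q => bd_integral w1 w2 (Phi q) s1 s2 t1 t2
    ) q0 (bd_integral w1 w2 Psi s1 s2 t1 t2).
Proof.
  intros Hs Ht HM H1 H2 H3 e He.
  set (L := Cmod w1 * (s2 - s1) + Cmod w2 * (t2 - t1)).
  assert (HL : 0 <= L).
  { unfold L. pose proof (Cmod_ge_0 w1). pose proof (Cmod_ge_0 w2).
    apply Rplus_le_le_0_compat; apply Rmult_le_pos; lra. }
  assert (ML : 0 <= M * L) by (apply Rmult_le_pos; lra).
  assert (N : near q0 (fun q => Cmod (q - q0) * (4 * (M * L) + 1) < e)).
  { exists (e / (4 * (M * L) + 1)). split; [apply Rdiv_lt_0_compat; lra|].
    intros q Hq. apply Rlt_div_r; [lra|exact Hq]. }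
  pose proof (near_self _ _ H1) as H0. simpl in H0.
  generalize (near_and _ _ _ N (near_and _ _ _ H1 H3)). apply near_impl.
  intros q [B1 [B2 B3]].
  assert (C2 : bd_all w1 w2 s1 s2 t1 t2 (Ccontinuous_at (fun z => RtoC (-1) * Phi q0 z)%C)).
  { intros s t Hst. apply Ccontinuous_mult; [apply Ccontinuous_const|apply H0, Hst]. }
  assert (C3 : bd_all w1 w2 s1 s2 t1 t2 (Ccontinuous_at (fun z => - (q - q0) * Psi z)%C)).
  { intros s t Hst. apply Ccontinuous_mult; [apply Ccontinuous_const|apply H2, Hst]. }
  assert (C23 : bd_all w1 w2 s1 s2 t1 t2
    (Ccontinuous_at (fun z => RtoC (-1) * Phi q0 z + - (q - q0) * Psi z)%C)).
  { intros s t Hst. apply Ccontinuous_plus; [apply C2, Hst|apply C3, Hst]. }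
  replace (bd_integral w1 w2 (Phi q) s1 s2 t1 t2 - bd_integral w1 w2 (Phi q0) s1 s2 t1 t2 -
    bd_integral w1 w2 Psi s1 s2 t1 t2 * (q - q0))%C with
    (bd_integral w1 w2 (fun z => Phi q z + (RtoC (-1) * Phi q0 z + - (q - q0) * Psi z))%C
      s1 s2 t1 t2).
  - eapply Rle_trans.
    + apply bd_integral_bound; try assumption; [|exact B3].
      intros s t Hst. apply Ccontinuous_plus; [apply B2, Hst|apply C23, Hst].
    + fold L. pose proof (Cmod_ge_0 (q - q0)).
      replace (4 * (M * (Cmod (q - q0) * Cmod (q - q0))) * L) with
        ((Cmod (q - q0) * (4 * (M * L))) * Cmod (q - q0)) by ring.
      apply Rmult_le_compat_r; lra.
  - rewrite (bd_integral_plus w1 w2 (Phi q)), bd_integral_plus, !bd_integral_scal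
    by assumption. ring.
Qed.

Lemma Cmod_inv_le (z : C) (d : R) : 0 < d -> d <= Cmod z -> Cmod (/ z) <= / d.
Proof.
  intros Hd H. rewrite Cmod_inv by (apply Cmod_gt_0; lra).
  apply Rinv_le_contravar; assumption.
Qed.

Lemma neq_of_dist (z q : C) (d : R) : 0 < d -> d <= Cmod (z - q) -> (z - q)%C <> RtoC 0.
Proof. intros Hd H. apply Cmod_gt_0. lra. Qed.

(** With [a = z - q0] and [b = z - q], the remainders of the two kernels are exactly [(q - q0) ^ 2]
    times [1 / (a ^ 2 * b)], respectively [1 / (a ^ 2 * b ^ 2) + 2 / (a ^ 3 * b)]. Both factors are
    bounded while [q0] and [q] stay away from the contour. *)
Lemma cauchy_type_derive (phi : C -> C) (q0 : C) (M d s1 s2 t1 t2 : R) :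
  s1 <= s2 -> t1 <= t2 -> 0 < d ->
  bd_all w1 w2 s1 s2 t1 t2 (Ccontinuous_at phi) ->
  bd_all w1 w2 s1 s2 t1 t2 (fun z => Cmod (phi z) <= M) ->
  bd_all w1 w2 s1 s2 t1 t2 (fun z => d <= Cmod (z - q0)) ->
  is_Cderive (fun q => bd_integral w1 w2 (fun z => phi z / (z - q))%C s1 s2 t1 t2) q0
    (bd_integral w1 w2 (fun z => phi z / ((z - q0) * (z - q0)))%C s1 s2 t1 t2) /\
  Cdifferentiable (fun q => bd_integral w1 w2
    (fun z => phi z / ((z - q) * (z - q)))%C s1 s2 t1 t2) q0.
Proof.
  intros Hs Ht Hd H1 H2 H3.
  assert (M0 : 0 <= M).
  { eapply Rle_trans; [apply Cmod_ge_0|apply (H2 s1 t1)]. unfold on_bd; lra. }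
  (* Within [d / 2] of [q0], the point [q] keeps the distance [d / 2] from the contour, so
     [A = 2 / d] bounds the inverses of both [z - q0] and [z - q]. *)
  assert (N : near q0 (fun q => bd_all w1 w2 s1 s2 t1 t2 (fun z => d / 2 <= Cmod (z - q)))).
  { exists (d / 2). split; [lra|]. intros q Hq s t Hst. specialize (H3 s t Hst).
    simpl in H3. pose proof (Cmod_triangle (pt w1 w2 s t - q) (q - q0)) as T.
    replace (pt w1 w2 s t - q + (q - q0))%C with (pt w1 w2 s t - q0)%C in T by ring.
    lra. }
  set (A := / (d / 2)).
  assert (A0 : 0 < A) by (apply Rinv_0_lt_compat; lra).
  assert (Tr : forall q z, Ccontinuous_at (fun z => z - q)%C z).
  { intros q z. apply Cdifferentiable_continuous, Cdifferentiable_translate. }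
  split.
  - apply (bd_integral_param_derive (fun q z => phi z / (z - q))%C _ _ (M * (A * A * A)));
      try assumption; [repeat apply Rmult_le_pos; lra| | |].
    + revert N. apply near_impl. intros q Hq s t Hst.
      apply Ccontinuous_mult; [apply H1, Hst|]. apply Ccontinuous_inv; [|apply Tr].
      apply (neq_of_dist _ _ (d / 2)); [lra|apply Hq, Hst].
    + intros s t Hst. apply Ccontinuous_mult; [apply H1, Hst|].
      apply Ccontinuous_inv; [|apply Ccontinuous_mult; apply Tr].
      apply Cmult_neq_0; apply (neq_of_dist _ _ d); try lra; apply H3, Hst.
    + revert N. apply near_impl. intros q Hq s t Hst.
      set (z := pt w1 w2 s t). specialize (H2 s t Hst). specialize (H3 s t Hst).
      specialize (Hq s t Hst). simpl in H2, H3, Hq. fold z in H2, H3, Hq.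
      pose proof (neq_of_dist _ _ _ Hd H3) as N1.
      pose proof (neq_of_dist z q (d / 2) ltac:(lra) Hq) as N2.
      pose proof (Cmod_inv_le (z - q0) (d / 2) ltac:(lra) ltac:(lra)) as I1.
      pose proof (Cmod_inv_le (z - q) (d / 2) ltac:(lra) ltac:(lra)) as I2.
      fold A in I1, I2.
      replace (phi z / (z - q) + (RtoC (-1) * (phi z / (z - q0)) +
        - (q - q0) * (phi z / ((z - q0) * (z - q0)))))%C with
        (phi z * (/ (z - q0) * / (z - q0) * / (z - q)) * ((q - q0) * (q - q0)))%C
        by (field; split; assumption).
      rewrite !Cmod_mult.
      apply Rmult_le_compat_r; [apply Rmult_le_pos; apply Cmod_ge_0|].
      repeat apply Rmult_le_compat; try assumption;
        repeat apply Rmult_le_pos; apply Cmod_ge_0.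
  - eexists.
    apply (bd_integral_param_derive (fun q z => phi z / ((z - q) * (z - q)))%C
      (fun z => RtoC 2 * phi z / ((z - q0) * (z - q0) * (z - q0)))%C _
      (M * (A * A * A * A + 2 * (A * A * A * A))));
      try assumption;
      [apply Rmult_le_pos; [lra|];
       assert (0 < A * A * A * A) by (repeat apply Rmult_lt_0_compat; lra); lra| | |].
    + revert N. apply near_impl. intros q Hq s t Hst.
      apply Ccontinuous_mult; [apply H1, Hst|].
      apply Ccontinuous_inv; [|apply Ccontinuous_mult; apply Tr].
      apply Cmult_neq_0; apply (neq_of_dist _ _ (d / 2)); try lra; apply Hq, Hst.
    + intros s t Hst. apply Ccontinuous_mult; [apply Ccontinuous_mult;
      [apply Ccontinuous_const|apply H1, Hst]|].
      apply Ccontinuous_inv; [|apply Ccontinuous_mult; [apply Ccontinuous_mult|]; apply Tr].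
      repeat apply Cmult_neq_0; apply (neq_of_dist _ _ d); try lra; apply H3, Hst.
    + revert N. apply near_impl. intros q Hq s t Hst.
      set (z := pt w1 w2 s t). specialize (H2 s t Hst). specialize (H3 s t Hst).
      specialize (Hq s t Hst). simpl in H2, H3, Hq. fold z in H2, H3, Hq.
      pose proof (neq_of_dist _ _ _ Hd H3) as N1.
      pose proof (neq_of_dist z q (d / 2) ltac:(lra) Hq) as N2.
      pose proof (Cmod_inv_le (z - q0) (d / 2) ltac:(lra) ltac:(lra)) as I1.
      pose proof (Cmod_inv_le (z - q) (d / 2) ltac:(lra) ltac:(lra)) as I2.
      fold A in I1, I2.
      replace (phi z / ((z - q) * (z - q)) +
        (RtoC (-1) * (phi z / ((z - q0) * (z - q0))) +
        - (q - q0) * (RtoC 2 * phi z / ((z - q0) * (z - q0) * (z - q0)))))%C with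
        (phi z * (/ (z - q0) * / (z - q0) * / (z - q) * / (z - q) +
          RtoC 2 * (/ (z - q0) * / (z - q0) * / (z - q0) * / (z - q)))
          * ((q - q0) * (q - q0)))%C
        by (field; split; assumption).
      rewrite (Cmod_mult _ ((q - q0) * (q - q0))), (Cmod_mult (q - q0)).
      apply Rmult_le_compat_r; [apply Rmult_le_pos; apply Cmod_ge_0|].
      rewrite Cmod_mult.
      apply Rmult_le_compat; try apply Cmod_ge_0; [assumption|].
      eapply Rle_trans; [apply Cmod_triangle|].
      rewrite !Cmod_mult, Cmod_R, (Rabs_pos_eq 2) by lra.
      apply Rplus_le_compat; [|apply Rmult_le_compat_l; [lra|]];
        repeat apply Rmult_le_compat; try assumption;
        repeat apply Rmult_le_pos; apply Cmod_ge_0.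
Qed.

Lemma holomorphic_box (p : C) (g : C -> C) :
  near p (Cdifferentiable g) -> exists x y e, p = pt w1 w2 x y /\ 0 < e /\
    box_all w1 w2 (x - e) (x + e) (y - e) (y + e) (Cdifferentiable g).
Proof.
  intros H. destruct (pt_coordinates w1 w2 p D) as [x [y E]]. subst p.
  destruct (near_box _ _ _ H) as [e [He K]]. exists x, y, e. auto.
Qed.

(** Inside a box Cauchy's formula writes [g] as a Cauchy integral of itself. Differentiating the
    kernel once gives the formula chosen for [g'], and differentiating it again shows [g'] to be
    differentiable. *)
Lemma derivative_holomorphic (p : C) (g : C -> C) :
  near p (Cdifferentiable g) ->
  exists g', near p (fun z => is_Cderive g z (g' z)) /\ near p (Cdifferentiable g').
Proof.
  intros H. destruct (holomorphic_box _ _ H) as [x [y [e [Ep [He HB]]]]].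
  assert (HC : box_all w1 w2 (x - e) (x + e) (y - e) (y + e) (Ccontinuous_at g)).
  { revert HB. apply box_impl. intros z. apply Cdifferentiable_continuous. }
  destruct (box_bounded g (x - e) (x + e) (y - e) (y + e)) as [M [HM B]];
    try lra; try exact HC.
  pose proof (near_interior (x - e) (x + e) (y - e) (y + e) x y ltac:(lra) ltac:(lra)) as I.
  rewrite <- Ep in I.
  exists (fun q => / winding_const * bd_integral w1 w2 (fun z => g z / ((z - q) * (z - q)))%C
    (x - e) (x + e) (y - e) (y + e))%C.
  assert (K : near p (fun q =>
    is_Cderive (fun q => bd_integral w1 w2
      (fun z => g z / (z - q))%C (x - e) (x + e) (y - e) (y + e)) q
      (bd_integral w1 w2 (fun z => g z / ((z - q) * (z - q)))%C (x - e) (x + e) (y - e) (y + e)) /\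
    Cdifferentiable (fun q => bd_integral w1 w2 (fun z => g z / ((z - q) * (z - q)))%C
      (x - e) (x + e) (y - e) (y + e)) q)).
  { revert I. apply near_impl. intros q [s [t [Eq [Hs Ht]]]].
    destruct (bd_dist (x - e) (x + e) (y - e) (y + e) s t Hs Ht) as [d [Hd Bd]].
    rewrite <- Eq in Bd.
    apply (cauchy_type_derive g q M d); try lra; try (apply box_bd; assumption). exact Bd. }
  split.
  - generalize (near_and _ _ _ K (near_near _ _ I)). apply near_impl.
    intros q [[K1 _] Iq].
    apply is_Cderive_ext with (fun q => / winding_const * bd_integral w1 w2
      (fun z => g z / (z - q))%C
      (x - e) (x + e) (y - e) (y + e))%C.
    + revert Iq. apply near_impl. intros z [s [t [Ez [Hs Ht]]]]. subst z.
      rewrite cauchy_formula by assumption. fold winding_const. field. exact winding_const_neq_0.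
    + pose proof (is_Cderive_mult _ _ _ _ _ (is_Cderive_const (/ winding_const) q) K1) as R.
      simpl in R. rewrite Cmult_0_l, Cplus_0_l in R. exact R.
  - revert K. apply near_impl. intros q [_ K2].
    apply Cdifferentiable_mult; [apply Cdifferentiable_const|exact K2].
Qed.

(** [h] is the Cauchy integral of [phi z = g z / (z - p)] over a contour around [p], so it is
    defined and differentiable at [p] as well. Integrating [g z / (z - q) = phi z + (q - p) * (phi z
    / (z - q))] and applying Cauchy's formula at [q] and at [p] gives the identity. *)
Lemma divided_difference_holomorphic (p : C) (g : C -> C) :
  near p (Cdifferentiable g) ->
  exists h, near p (Cdifferentiable h) /\ near p (fun z => g z = g p + (z - p) * h z)%C.
Proof.
  intros H. destruct (holomorphic_box _ _ H) as [x [y [e [Ep [He HB]]]]].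
  assert (HC : box_all w1 w2 (x - e) (x + e) (y - e) (y + e) (Ccontinuous_at g)).
  { revert HB. apply box_impl. intros z. apply Cdifferentiable_continuous. }
  destruct (box_bounded g (x - e) (x + e) (y - e) (y + e)) as [M [HM B]];
    try lra; try exact HC.
  pose proof (near_interior (x - e) (x + e) (y - e) (y + e) x y ltac:(lra) ltac:(lra)) as I.
  rewrite <- Ep in I.
  destruct (bd_dist (x - e) (x + e) (y - e) (y + e) x y ltac:(lra) ltac:(lra))
    as [d0 [Hd0 Bp]].
  rewrite <- Ep in Bp.
  set (phi := fun z => (g z / (z - p))%C).
  assert (Cphi : bd_all w1 w2 (x - e) (x + e) (y - e) (y + e) (Ccontinuous_at phi)).
  { intros s t Hst. apply Ccontinuous_mult; [apply box_bd in HC; apply HC, Hst|].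
    apply Ccontinuous_inv; [|apply Cdifferentiable_continuous, Cdifferentiable_translate].
    apply (neq_of_dist _ _ d0); [exact Hd0|apply Bp, Hst]. }
  assert (Bphi : bd_all w1 w2 (x - e) (x + e) (y - e) (y + e)
    (fun z => Cmod (phi z) <= M * / d0)).
  { intros s t Hst. unfold phi, Cdiv. rewrite Cmod_mult.
    apply Rmult_le_compat; try apply Cmod_ge_0; [apply box_bd in B; apply B, Hst|].
    apply Cmod_inv_le; [exact Hd0|apply Bp, Hst]. }
  exists (fun q => / winding_const * bd_integral w1 w2 (fun z => phi z / (z - q))%C
    (x - e) (x + e) (y - e) (y + e))%C.
  split; revert I; apply near_impl; intros q [s [t [Eq [Hs Ht]]]];
    destruct (bd_dist (x - e) (x + e) (y - e) (y + e) s t Hs Ht) as [d [Hd Bd]];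
    rewrite <- Eq in Bd.
  - apply Cdifferentiable_mult; [apply Cdifferentiable_const|]. eexists.
    apply (cauchy_type_derive phi q (M * / d0) d); try lra; assumption.
  - pose proof (cauchy_formula w1 w2 D g _ _ _ _ s t Hs Ht HB) as E1.
    pose proof (cauchy_formula w1 w2 D g (x - e) (x + e) (y - e) (y + e) x y
      ltac:(lra) ltac:(lra) HB) as E2.
    fold winding_const in E1, E2. rewrite <- Eq in E1. rewrite <- Ep in E2.
    assert (Cq : bd_all w1 w2 (x - e) (x + e) (y - e) (y + e)
      (Ccontinuous_at (fun z => phi z / (z - q))%C)).
    { intros a b Hab. apply Ccontinuous_mult; [apply Cphi, Hab|].
      apply Ccontinuous_inv; [|apply Cdifferentiable_continuous, Cdifferentiable_translate].
      apply (neq_of_dist _ _ d); [exact Hd|apply Bd, Hab]. }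
    rewrite (bd_integral_ext w1 w2 _ (fun z => phi z + (q - p) * (phi z / (z - q)))%C) in E1; try lra.
    + rewrite bd_integral_plus, bd_integral_scal in E1; try lra; try assumption.
      * fold phi in E2. rewrite E2 in E1.
        replace (g q) with (/ winding_const * (winding_const * g q))%C
          by (field; exact winding_const_neq_0).
        rewrite <- E1. field. exact winding_const_neq_0.
      * intros a b Hab. apply Ccontinuous_mult; [apply Ccontinuous_const|apply Cq, Hab].
    + intros a b Hab. unfold phi. field. split.
      * apply (neq_of_dist _ _ d0); [exact Hd0|apply Bp, Hab].
      * apply (neq_of_dist _ _ d); [exact Hd|apply Bd, Hab].
Qed.

(** If no order exists, [g] can be divided by [z - p] forever on one and the same box. On its
    contour the [n]-th quotient is at most [M / d ^ n], so Cauchy's formula bounds [g q] by a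
    constant times [(Cmod (q - p) / d) ^ n], which tends to [0]. *)
Lemma holomorphic_order (p : C) (g : C -> C) :
  near p (Cdifferentiable g) ->
  near p (fun z => g z = RtoC 0) \/
  exists n h, near p (Cdifferentiable h) /\ h p <> RtoC 0 /\
    near p (fun z => g z = (z - p) ^ n * h z)%C.
Proof.
  intros H. apply NNPP. intros N. apply not_or_and in N. destruct N as [N1 N2].
  apply N1. clear N1.
  destruct (holomorphic_box _ _ H) as [x [y [e [Ep [He HB]]]]].
  assert (HC : box_all w1 w2 (x - e) (x + e) (y - e) (y + e) (Ccontinuous_at g)).
  { revert HB. apply box_impl. intros z. apply Cdifferentiable_continuous. }
  destruct (box_bounded g (x - e) (x + e) (y - e) (y + e)) as [M [HM B]];
    try lra; try exact HC.
  pose proof (near_interior (x - e) (x + e) (y - e) (y + e) x y ltac:(lra) ltac:(lra)) as I.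
  rewrite <- Ep in I.
  assert (quot : forall n, exists h,
    box_all w1 w2 (x - e) (x + e) (y - e) (y + e) (Cdifferentiable h) /\
    box_all w1 w2 (x - e) (x + e) (y - e) (y + e) (fun z => g z = (z - p) ^ n * h z)%C).
  { induction n as [|n [h [Hh E]]].
    - exists g. split; [exact HB|]. intros s t _ _. simpl. ring.
    - assert (Np : near p (Cdifferentiable h)).
      { revert I. apply near_impl. intros z [s [t [-> [Hs Ht]]]]. apply Hh; lra. }
      assert (hp : h p = RtoC 0).
      { apply NNPP. intros hp. apply N2. exists n, h. split; [exact Np|].
        split; [exact hp|]. revert I. apply near_impl.
        intros z [s [t [-> [Hs Ht]]]]. apply E; lra. }
      destruct (divided_difference_holomorphic p h Np) as [k [Hk Ek]].
      (* Away from [p] this is the plain quotient; near [p] it coincides with the divided difference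
         [k]. Hence it is differentiable on the whole box, which must not shrink with [n]. *)
      set (h' := fun z => if excluded_middle_informative (z = p) then k p
        else (h z / (z - p))%C).
      assert (offp : forall z, z <> p -> h' z = (h z / (z - p))%C).
      { intros z Hz. unfold h'. destruct excluded_middle_informative; tauto. }
      exists h'. split; intros s t Hs Ht; set (z := pt w1 w2 s t);
        destruct (excluded_middle_informative (z = p)) as [Ez|Nz].
      + rewrite Ez. apply Cdifferentiable_ext with k; [|apply near_self, Hk].
        revert Ek. apply near_impl. intros u Eu. unfold h'.
        destruct (excluded_middle_informative (u = p)) as [->|Nu]; [reflexivity|].
        rewrite Eu, hp. field. intros F. apply Nu, Ceq_minus, F.
      + apply Cdifferentiable_ext with (fun u => h u / (u - p))%C.
        * generalize (near_neq z p Nz). apply near_impl. intros u Nu.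
          symmetry. apply offp, Nu.
        * apply Cdifferentiable_div; [|apply Hh; assumption|apply Cdifferentiable_translate].
          intros F. apply Nz, Ceq_minus, F.
      + fold z. specialize (E s t Hs Ht). simpl in E. fold z in E. rewrite E, Ez, hp.
        simpl. rewrite Cminus_diag. ring.
      + specialize (E s t Hs Ht). simpl in E. fold z in E. rewrite E, offp by exact Nz.
        simpl. field. intros F. apply Nz, Ceq_minus, F. }
  destruct (bd_dist (x - e) (x + e) (y - e) (y + e) x y ltac:(lra) ltac:(lra))
    as [d [Hd Bp]].
  rewrite <- Ep in Bp.
  (* The radius [d / 2] makes the ratio of the geometric bound [1 / 2] and keeps [q] at distance at
     least [d / 2] from the contour. *)
  assert (Nd : near p (fun q => Cmod (q - p) < d / 2)) by (exists (d / 2); split; [lra|auto]).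
  generalize (near_and _ _ _ Nd I). apply near_impl.
  intros q [Hq [s [t [Eq [Hs Ht]]]]].
  set (L := Cmod w1 * (x + e - (x - e)) + Cmod w2 * (y + e - (y - e))).
  assert (HL : 0 <= L).
  { unfold L. pose proof (Cmod_ge_0 w1). pose proof (Cmod_ge_0 w2).
    apply Rplus_le_le_0_compat; apply Rmult_le_pos; lra. }
  assert (KP : 0 < Cmod winding_const) by (apply Cmod_gt_0, winding_const_neq_0).
  set (A := / Cmod winding_const * (4 * (M * / (d / 2)) * L)).
  assert (HA : 0 <= A).
  { unfold A. pose proof (Rinv_0_lt_compat _ KP).
    pose proof (Rinv_0_lt_compat (d / 2) ltac:(lra)).
    repeat apply Rmult_le_pos; lra. }
  assert (bound : forall n, Cmod (g q) <= A * (1 / 2) ^ n).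
  { intros n. destruct (quot n) as [h [Hh E]].
    pose proof (cauchy_formula w1 w2 D h _ _ _ _ s t Hs Ht Hh) as F.
    fold winding_const in F. rewrite <- Eq in F.
    assert (dn : 0 < d ^ n) by (apply pow_lt; lra).
    assert (BB : Cmod (bd_integral w1 w2
      (fun z => h z / (z - q))%C (x - e) (x + e) (y - e) (y + e))
      <= 4 * ((M * / d ^ n) * / (d / 2)) * L).
    { assert (Q : bd_all w1 w2 (x - e) (x + e) (y - e) (y + e)
        (fun z => d / 2 <= Cmod (z - q))).
      { intros a b Hab. specialize (Bp a b Hab). simpl in Bp.
        pose proof (Cmod_triangle (pt w1 w2 a b - q) (q - p)) as T.
        replace (pt w1 w2 a b - q + (q - p))%C with (pt w1 w2 a b - p)%C in T by ring.
        lra. }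
      apply bd_integral_bound; try lra; intros a b Hab.
      - apply Ccontinuous_mult; [apply box_bd in Hh; apply Cdifferentiable_continuous, Hh, Hab|].
        apply Ccontinuous_inv; [|apply Cdifferentiable_continuous, Cdifferentiable_translate].
        apply (neq_of_dist _ _ (d / 2)); [lra|apply Q, Hab].
      - unfold Cdiv. rewrite Cmod_mult.
        apply Rmult_le_compat; try apply Cmod_ge_0.
        + apply box_bd in E. specialize (E a b Hab). simpl in E.
          apply box_bd in B. specialize (B a b Hab). simpl in B.
          specialize (Bp a b Hab). simpl in Bp.
          rewrite E, Cmod_mult, Cmod_pow in B.
          apply Rle_div_r; [exact dn|].
          apply Rle_trans with (Cmod (h (pt w1 w2 a b)) * Cmod (pt w1 w2 a b - p) ^ n);
            [|lra].
          apply Rmult_le_compat_l; [apply Cmod_ge_0|]. apply pow_incr. lra.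
        + apply Cmod_inv_le; [lra|apply Q, Hab]. }
    rewrite F, Cmod_mult in BB.
    assert (Eg : g q = ((q - p) ^ n * h q)%C) by (rewrite Eq; apply E; lra).
    rewrite Eg, Cmod_mult, Cmod_pow.
    assert (B1 : Cmod (q - p) ^ n <= (d / 2) ^ n).
    { apply pow_incr. pose proof (Cmod_ge_0 (q - p)). lra. }
    assert (B2 : Cmod (h q) <= / Cmod winding_const * (4 * (M * / d ^ n * / (d / 2)) * L)).
    { apply Rmult_le_reg_l with (Cmod winding_const); [exact KP|].
      replace (Cmod winding_const * (/ Cmod winding_const * (4 * (M * / d ^ n * / (d / 2)) * L)))
        with (4 * (M * / d ^ n * / (d / 2)) * L) by (field; lra).
      exact BB. }
    replace (A * (1 / 2) ^ n) with
      ((d / 2) ^ n * (/ Cmod winding_const * (4 * (M * / d ^ n * / (d / 2)) * L))).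
    - apply Rmult_le_compat; try assumption; [apply pow_le|]; apply Cmod_ge_0.
    - unfold A, Rdiv. rewrite Rpow_mult_distr, Rmult_1_l. field. lra. }
  apply Cmod_eq_0, Rle_antisym; [|apply Cmod_ge_0].
  apply le_epsilon. intros eps Heps. rewrite Rplus_0_l.
  destruct (pow_lt_1_zero (1 / 2) ltac:(rewrite Rabs_pos_eq; lra) (eps / (A + 1)))
    as [n Hn]; [apply Rdiv_lt_0_compat; lra|].
  specialize (Hn n (Nat.le_refl n)). rewrite Rabs_pos_eq in Hn by (apply pow_le; lra).
  apply Rlt_div_r in Hn; [|lra].
  eapply Rle_trans; [apply (bound n)|].
  assert (0 <= (1 / 2) ^ n) by (apply pow_le; lra). nra.
Qed.

End Local_structure.

(** * Orders and logarithmic derivatives of a meromorphic function *)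

Section Meromorphic.

Variables w1 w2 : C.
Hypothesis D : cross w1 w2 <> 0.
Variable f : C -> option C.

(** This says that [f] is [(z - p) ^ k * h z] near [p], with [k] in [Z]. Powers being natural, the
    sign of [k] is split. For [k >= 0] the formula also fixes [f p]; for [k < 0] it leaves [p] out,
    where the value is infinity. *)
Definition ord_data (p : C) (k : Z) (h : C -> C) : Prop :=
  near p (Cdifferentiable h) /\ h p <> RtoC 0 /\
  (((0 <= k)%Z /\ near p (fun z => f z = Some ((z - p) ^ Z.to_nat k * h z)%C)) \/
   ((k < 0)%Z /\ f p = None /\
    near' p (fun z => f z = Some (h z / (z - p) ^ Z.to_nat (- k))%C))).

Lemma local_form (p : C) :
  meromorphic f -> near p (fun z => f z = Some (RtoC 0)) \/ exists k h, ord_data p k h.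
Proof.
  intros mf. destruct (mf p) as [[g [Hg Eg]]|[n [Hn [Fp [g [Hg [gp Eg]]]]]]].
  - apply holomorphic_near in Hg. apply locally_near in Eg.
    destruct (holomorphic_order w1 w2 D p g Hg) as [Z|[n [h [Hh [hp E]]]]].
    + left. generalize (near_and _ _ _ Eg Z). apply near_impl.
      intros z [E1 E2]. rewrite E1, E2. reflexivity.
    + right. exists (Z.of_nat n), h. split; [exact Hh|]. split; [exact hp|].
      left. split; [lia|]. rewrite Nat2Z.id.
      generalize (near_and _ _ _ Eg E). apply near_impl.
      intros z [E1 E2]. rewrite E1, E2. reflexivity.
  - apply holomorphic_near in Hg. right. exists (- Z.of_nat n)%Z, g.
    split; [exact Hg|]. split; [exact gp|]. right.
    rewrite Z.opp_involutive, Nat2Z.id. split; [lia|]. split; [exact Fp|].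
    apply locally_near in Eg. exact Eg.
Qed.

Lemma ord_data_pos (p : C) (k : Z) (h : C -> C) :
  ord_data p k h -> (0 < k)%Z ->
  f p = Some (RtoC 0) /\ zero_of_order f p (Z.to_nat k).
Proof.
  intros [Hh [hp [[_ E]|[K _]]]] Hk; [|lia]. split.
  - rewrite (near_self _ _ E), Cminus_diag.
    destruct (Z.to_nat k) as [|n] eqn:En; [lia|]. simpl. f_equal. ring.
  - split; [lia|]. exists h. split; [apply holomorphic_near, Hh|]. split; [exact hp|].
    apply locally_near, E.
Qed.

Lemma ord_data_neg (p : C) (k : Z) (h : C -> C) :
  ord_data p k h -> (k < 0)%Z -> f p = None /\ pole_of_order f p (Z.to_nat (- k)).
Proof.
  intros [Hh [hp [[K _]|[_ [Fp E]]]]] Hk; [lia|]. split; [exact Fp|].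
  split; [lia|]. split; [exact Fp|]. exists h.
  split; [apply holomorphic_near, Hh|]. split; [exact hp|]. apply locally_near, E.
Qed.

Lemma ord_data_0 (p : C) (h : C -> C) :
  ord_data p 0 h <->
  near p (Cdifferentiable h) /\ h p <> RtoC 0 /\ near p (fun z => f z = Some (h z)).
Proof.
  assert (E : forall z, ((z - p) ^ Z.to_nat 0 * h z)%C = h z) by (intros z; simpl; ring).
  split; intros [Hh [hp H]]; (split; [exact Hh|]); (split; [exact hp|]).
  - destruct H as [[_ H]|[K _]]; [|lia]. revert H. apply near_impl.
    intros z. rewrite E. tauto.
  - left. split; [lia|]. revert H. apply near_impl. intros z. rewrite E. tauto.
Qed.

(** [v] is the constant term at [p] of the Laurent expansion of the logarithmic derivative of [f];
    for [k = 0] it is its value. *)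
Definition log_derivative (p : C) (k : Z) (v : C) : Prop :=
  exists h d, ord_data p k h /\ is_Cderive h p d /\ v = (d / h p)%C.

(** Order [0] is visible in the value [f p], which is finite and nonzero, whereas other orders give
    zero or infinity. Both cofactors then equal [f] near [p]. *)
Lemma log_derivative_unique (p : C) (k : Z) (u v : C) :
  log_derivative p 0 u -> log_derivative p k v -> k = 0%Z /\ v = u.
Proof.
  intros [g [d [Hg [Dg ->]]]] [h [e [Hh [Dh ->]]]].
  apply ord_data_0 in Hg. destruct Hg as [Hg [gp Eg]].
  assert (k = 0%Z).
  { pose proof (near_self _ _ Eg) as E. simpl in E.
    destruct (Z.lt_trichotomy k 0) as [K|[K|K]]; [exfalso|exact K|exfalso].
    - destruct (ord_data_neg _ _ _ Hh K). congruence.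
    - destruct (ord_data_pos _ _ _ Hh K). congruence. }
  split; [assumption|]. subst k.
  apply ord_data_0 in Hh. destruct Hh as [Hh [hp Eh]].
  assert (E : near p (fun z => h z = g z)).
  { generalize (near_and _ _ _ Eg Eh). apply near_impl. intros z [A B]. congruence. }
  rewrite (near_self _ _ E). f_equal.
  apply (is_Cderive_unique g p); [|exact Dg]. apply is_Cderive_ext with h; assumption.
Qed.

(** Dividing by [z - p] avoids the exponent [n - 1] and fits the form [k / (z - p)] of the
    logarithmic derivative. *)
Lemma is_Cderive_pow_translate (p z : C) (n : nat) :
  z <> p -> is_Cderive (fun u => (u - p) ^ n)%C z (RtoC (INR n) * (z - p) ^ n / (z - p))%C.
Proof.
  intros N. assert (N' : (z - p)%C <> RtoC 0) by (intros E; apply N, Ceq_minus, E).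
  assert (T : is_Cderive (fun u => u - p)%C z (RtoC 1)).
  { pose proof (is_Cderive_plus _ _ _ _ _ (is_Cderive_id z) (is_Cderive_const (- p)%C z)) as T.
    rewrite Cplus_0_r in T. exact T. }
  induction n as [|n IH].
  - replace (RtoC (INR 0) * (z - p) ^ 0 / (z - p))%C with (RtoC 0)
      by (simpl; field; exact N').
    exact (is_Cderive_const (RtoC 1) z).
  - replace (RtoC (INR (S n)) * (z - p) ^ S n / (z - p))%C with
      (RtoC 1 * (z - p) ^ n + (z - p) * (RtoC (INR n) * (z - p) ^ n / (z - p)))%C.
    + apply (is_Cderive_mult (fun u => u - p)%C (fun u => (u - p) ^ n)%C); assumption.
    + rewrite S_INR, RtoC_plus. simpl. field. exact N'.
Qed.

(** The logarithmic derivative of [(z - p) ^ k * h z] is [k / (z - p) + h' z / h z]. At [z <> p]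
    close to [p], the product itself serves as the cofactor for order [0]. *)
Lemma log_derivative_near (p : C) (k : Z) (h h' : C -> C) :
  ord_data p k h -> near p (fun z => is_Cderive h z (h' z)) ->
  near' p (fun z => log_derivative z 0 (RtoC (IZR k) / (z - p) + h' z / h z)%C).
Proof.
  intros [Hh [hp H]] Hd.
  assert (Nh : near p (fun z => h z <> RtoC 0)).
  { apply (Ccontinuous_near h p (fun u => u <> RtoC 0)); [|apply near_neq, hp].
    apply Cdifferentiable_continuous. apply (near_self _ _ Hh). }
  assert (Ng : forall n z, z <> p -> ((z - p) ^ n)%C <> RtoC 0).
  { intros n z N. apply Cpow_nz. intros E. apply N, Ceq_minus, E. }
  generalize (near_and _ _ _ Nh (near_and _ _ _ Hd (near_near _ _ Hh))).
  destruct H as [[Hk E]|[Hk [_ E]]].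
  - intros B. generalize (near_and _ _ _ B (near_near _ _ E)). apply near_impl.
    intros z [[hz [Dz Hz]] Ez] N.
    assert (N' : (z - p)%C <> RtoC 0) by (intros F; apply N, Ceq_minus, F).
    set (n := Z.to_nat k) in *.
    exists (fun u => (u - p) ^ n * h u)%C,
      (RtoC (INR n) * (z - p) ^ n / (z - p) * h z + (z - p) ^ n * h' z)%C.
    split; [|split].
    + apply ord_data_0. split; [|split].
      * revert Hz. apply near_impl. intros u Hu.
        apply Cdifferentiable_mult; [apply Cdifferentiable_pow, Cdifferentiable_translate|exact Hu].
      * apply Cmult_neq_0; [apply Ng, N|exact hz].
      * exact Ez.
    + apply (is_Cderive_mult (fun u => (u - p) ^ n)%C);
      [apply is_Cderive_pow_translate, N|exact Dz].
    + replace (IZR k) with (INR n) by (unfold n; rewrite INR_IZR_INZ; f_equal; lia).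
      pose proof (Ng n z N). field. repeat split; assumption.
  (* At a pole the formula for [f] fails at [p], so each [z <> p] gets a neighbourhood of its own
     that avoids [p]. *)
  - apply near'_off in E. intros B. generalize (near_and _ _ _ B E). apply near_impl.
    intros z [[hz [Dz Hz]] Ez] N. specialize (Ez N).
    assert (N' : (z - p)%C <> RtoC 0) by (intros F; apply N, Ceq_minus, F).
    set (n := Z.to_nat (- k)) in *.
    exists (fun u => h u * / (u - p) ^ n)%C,
      (h' z * / (z - p) ^ n + h z * (- (RtoC (INR n) * (z - p) ^ n / (z - p)) /
        ((z - p) ^ n * (z - p) ^ n)))%C.
    split; [|split].
    + apply ord_data_0. split; [|split].
      * generalize (near_and _ _ _ Hz (near_neq _ _ N)). apply near_impl.
        intros u [Hu Nu]. apply Cdifferentiable_div; [apply Ng, Nu|exact Hu|].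
        apply Cdifferentiable_pow, Cdifferentiable_translate.
      * apply Cmult_neq_0; [exact hz|]. intros F.
        apply C1_nz. rewrite <- (Cinv_r ((z - p) ^ n)%C) by apply Ng, N.
        rewrite F. ring.
      * exact Ez.
    + apply (is_Cderive_mult h (fun u => / (u - p) ^ n)%C); [exact Dz|].
      apply (is_Cderive_inv (fun u => (u - p) ^ n)%C);
        [apply Ng, N|apply is_Cderive_pow_translate, N].
    + replace (IZR k) with (- INR n)
        by (unfold n; rewrite INR_IZR_INZ, <- opp_IZR; f_equal; lia).
      rewrite RtoC_opp.
      pose proof (Ng n z N). field. repeat split; assumption.
Qed.

Lemma log_derivative_translate (w p v : C) :
  (forall z, f (z + w)%C = f z) -> log_derivative p 0 v -> log_derivative (p + w)%C 0 v.
Proof.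
  intros per [h [d [Hh [Dh ->]]]]. apply ord_data_0 in Hh. destruct Hh as [Hh [hp E]].
  assert (sh : forall q (P : C -> Prop), near q P -> near (q + w)%C (fun z => P (z - w)%C)).
  { intros q P [e [He K]]. exists e. split; [exact He|]. intros z Hz. apply K.
    replace (z - w - q)%C with (z - (q + w))%C by ring. exact Hz. }
  assert (shD : forall q c, is_Cderive h q c -> is_Cderive (fun z => h (z - w)%C) (q + w)%C c).
  { intros q c H e He. generalize (sh _ _ (H e He)). apply near_impl. intros z.
    replace (q + w - w)%C with q by ring.
    replace (z - w - q)%C with (z - (q + w))%C by ring. tauto. }
  exists (fun z => h (z - w)%C), d.
  replace (p + w - w)%C with p by ring. split; [|split; [apply shD, Dh|reflexivity]].
  apply ord_data_0. replace (p + w - w)%C with p by ring. split; [|split; [exact hp|]].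
  - generalize (sh _ _ Hh). apply near_impl. intros z [c Hc]. exists c.
    replace z with ((z - w) + w)%C at 1 by ring. apply shD, Hc.
  - generalize (sh _ _ E). apply near_impl. intros z Hz. rewrite <- Hz.
    rewrite <- (per (z - w)%C). f_equal. ring.
Qed.

Lemma nonsingular_near (p : C) (k : Z) (h : C -> C) :
  ord_data p k h -> near' p (fun z => exists v, log_derivative z 0 v).
Proof.
  intros H. pose proof H as [Hh _].
  destruct (derivative_holomorphic w1 w2 D p h Hh) as [h' [Hd _]].
  generalize (log_derivative_near p k h h' H Hd). apply near_impl.
  intros z K N. eexists. apply K, N.
Qed.

Lemma log_derivative_0_value (p v : C) :
  log_derivative p 0 v -> exists c, c <> RtoC 0 /\ f p = Some c.
Proof.
  intros [h [d [H _]]]. apply ord_data_0 in H. destruct H as [_ [hp E]].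
  exists (h p). split; [exact hp|apply (near_self _ _ E)].
Qed.

(** Identity theorem by connectedness: [U] is open, and so is its complement by the local form of
    [f]. Hence small boxes lie wholly inside or wholly outside [U], and bisection extends this to a
    box containing both [p] and [z]. *)
Lemma not_locally_zero :
  meromorphic f -> ~ (forall z, f z = Some (RtoC 0)) ->
  forall p, ~ near p (fun z => f z = Some (RtoC 0)).
Proof.
  intros mf nz p Hp. apply nz. intros z.
  set (U := fun q => near q (fun z => f z = Some (RtoC 0))).
  destruct (pt_coordinates w1 w2 p D) as [x [y Ep]].
  destruct (pt_coordinates w1 w2 z D) as [s [t Ez]].
  set (r := Rabs x + Rabs y + Rabs s + Rabs t + 1).
  assert (bnds : - r <= x <= r /\ - r <= y <= r /\ - r <= s <= r /\ - r <= t <= r).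
  { unfold r. pose proof (Rabs_pos x). pose proof (Rabs_pos y).
    pose proof (Rabs_pos s). pose proof (Rabs_pos t).
    pose proof (Rle_abs x). pose proof (Rle_abs (- x)).
    pose proof (Rle_abs y). pose proof (Rle_abs (- y)).
    pose proof (Rle_abs s). pose proof (Rle_abs (- s)).
    pose proof (Rle_abs t). pose proof (Rle_abs (- t)).
    rewrite !Rabs_Ropp in *. lra. }
  assert (K : box_all w1 w2 (- r) r (- r) r U \/
    box_all w1 w2 (- r) r (- r) r (fun q => ~ U q)).
  { assert (r0 : 0 < r).
    { unfold r. pose proof (Rabs_pos x). pose proof (Rabs_pos y).
      pose proof (Rabs_pos s). pose proof (Rabs_pos t). lra. }
    apply (box_induction_near w1 w2 (fun a b c d => box_all w1 w2 a b c d U \/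
      box_all w1 w2 a b c d (fun q => ~ U q))); try lra.
    - intros a m b c d Hm Hc [H1|H1] [H2|H2].
      + left. intros u v Hu Hv. destruct (Rle_dec u m); [apply H1|apply H2]; lra.
      (* Adjacent boxes share an edge, so they cannot be of different kinds. *)
      + exfalso. apply (H2 m c); try lra. apply H1; lra.
      + exfalso. apply (H1 m c); try lra. apply H2; lra.
      + right. intros u v Hu Hv. destruct (Rle_dec u m); [apply H1|apply H2]; lra.
    - intros a b c m d Hb Hm [H1|H1] [H2|H2].
      + left. intros u v Hu Hv. destruct (Rle_dec v m); [apply H1|apply H2]; lra.
      + exfalso. apply (H2 a m); try lra. apply H1; lra.
      + exfalso. apply (H1 a m); try lra. apply H2; lra.
      + right. intros u v Hu Hv. destruct (Rle_dec v m); [apply H1|apply H2]; lra.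
    - intros u v _ _. set (q := pt w1 w2 u v).
      destruct (local_form q mf) as [Z|[k [h H]]].
      + exists U. split; [apply near_near, Z|]. intros. left. assumption.
      + exists (fun q => ~ U q). split; [|intros; right; assumption].
        pose proof (nonsingular_near q k h H) as N.
        assert (NU : near' q (fun z => ~ U z)).
        { revert N. apply near_impl. intros z' N1 N2 Uz. destruct (N1 N2) as [v' Hv'].
          apply log_derivative_0_value in Hv'. destruct Hv' as [c [c0 Ec]].
          apply near_self in Uz. congruence. }
        (* The centre [q] is outside [U] too: otherwise some nearby point would be both inside and
           outside. *)
        generalize NU. apply near_impl. intros z' N1.
        destruct (Ceq_dec z' q) as [->|N2]; [|apply N1, N2].
        intros Uq. apply near_near in Uq.
        destruct (near'_exists q (fun z => ~ U z /\ U z)) as [z'' [_ [A B]]].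
        { generalize (near_and _ _ _ NU Uq). apply near_impl. tauto. }
        contradiction. }
  destruct K as [K|K].
  - rewrite Ez. apply (near_self _ _ (K s t ltac:(lra) ltac:(lra))).
  - exfalso. apply (K x y); try lra. rewrite <- Ep. exact Hp.
Qed.

End Meromorphic.

(** * The divisor of an elliptic function *)

Definition Csum (g : C -> C) (l : list C) : C :=
  fold_right (fun p c => (g p + c)%C) (RtoC 0) l.

Definition Zsum (k : C -> Z) (l : list C) : Z :=
  fold_right (fun p c => (k p + c)%Z) 0%Z l.

Lemma Csum_remove (g : C -> C) (l : list C) (p : C) :
  NoDup l -> In p l -> Csum g l = (g p + Csum g (remove Ceq_dec p l))%C.
Proof.
  induction l as [|q l IH]; [intros _ []|]. intros Hl Hp.
  apply NoDup_cons_iff in Hl. destruct Hl as [Hq Hl]. simpl.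
  destruct (Ceq_dec p q) as [->|N].
  - rewrite notin_remove by exact Hq. reflexivity.
  - destruct Hp as [E|Hp]; [congruence|]. rewrite IH by assumption. simpl. ring.
Qed.

Lemma Csum_Cdifferentiable (g : C -> C -> C) (l : list C) (z : C) :
  (forall p, In p l -> Cdifferentiable (fun z => g z p) z) -> Cdifferentiable
    (fun z => Csum (g z) l) z.
Proof.
  induction l as [|p l IH]; intros H; simpl; [apply Cdifferentiable_const|].
  apply (Cdifferentiable_plus (fun z => g z p) (fun z => Csum (g z) l)).
  - apply H. left. reflexivity.
  - apply IH. intros q Hq. apply H. right. exact Hq.
Qed.

(** The two intervals are what [[- e', 1 - e')] gains and loses against [[0, 1)]; both shrink to
    nothing as [e'] tends to [0]. *)
Lemma exists_margin (s : R) : exists e, 0 < e /\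
  forall e', 0 < e' <= e -> ~ (- e' <= s < 0) /\ ~ (1 - e' <= s < 1).
Proof.
  destruct (Rlt_dec s 0).
  - exists (Rmin (- s / 2) 1). split; [apply Rmin_pos; lra|]. intros e' He.
    pose proof (Rmin_l (- s / 2) 1). pose proof (Rmin_r (- s / 2) 1). lra.
  - destruct (Rlt_dec s 1).
    + exists ((1 - s) / 2). split; [lra|]. intros e' He. lra.
    + exists 1. split; [lra|]. intros e' He. lra.
Qed.

Section Elliptic.

Variables w1 w2 : C.
Hypothesis D : cross w1 w2 <> 0.
Variable f : C -> option C.
Hypothesis mf : meromorphic f.
Hypothesis nonzero : forall p, ~ near p (fun z => f z = Some (RtoC 0)).

(** A choice made once for all points, so that [lam] is a function that can be integrated. Where the
    order is [0], [log_derivative_unique] forces its value. *)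
Lemma ord_log_derivative_exist :
  exists (ord : C -> Z) (lam : C -> C), forall p, log_derivative f p (ord p) (lam p).
Proof.
  assert (E : forall p, exists kv : Z * C, log_derivative f p (fst kv) (snd kv)).
  { intros p. destruct (local_form w1 w2 D f p mf) as [Z|[k [h H]]].
    - destruct (nonzero p Z).
    - pose proof H as [Hh _]. destruct (near_self _ _ Hh) as [d Hd].
      exists (k, (d / h p)%C), h, d. auto. }
  exists (fun p => fst (proj1_sig (constructive_indefinite_description _ (E p)))),
    (fun p => snd (proj1_sig (constructive_indefinite_description _ (E p)))).
  intros p. destruct (constructive_indefinite_description _ (E p)) as [kv H]. exact H.
Qed.

Variable ord : C -> Z.
Variable lam : C -> C.
Hypothesis ordlam : forall p, log_derivative f p (ord p) (lam p).

Lemma ord_eq_0_near (p : C) : near' p (fun z => ord z = 0%Z).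
Proof.
  destruct (ordlam p) as [h [d [H _]]].
  generalize (nonsingular_near w1 w2 D f p _ h H). apply near_impl.
  intros z K N. destruct (K N) as [v Hv].
  apply (log_derivative_unique f z _ _ _ Hv (ordlam z)).
Qed.

(** Around any point only that point can be singular, so a one-element list serves small boxes;
    lists are concatenated when boxes are glued. *)
Lemma singular_finite (s1 s2 t1 t2 : R) : s1 < s2 -> t1 < t2 ->
  exists l, box_all w1 w2 s1 s2 t1 t2 (fun z => ord z <> 0%Z -> In z l).
Proof.
  intros Hs Ht. apply (box_induction_near w1 w2 (fun a b c d =>
    exists l, box_all w1 w2 a b c d (fun z => ord z <> 0%Z -> In z l))); try assumption.
  - intros a m b c d _ _ [l H] [l' H']. exists (l ++ l'). intros u v Hu Hv N.
    apply in_or_app. destruct (Rle_dec u m).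
    + left. apply H; try lra. exact N.
    + right. apply H'; try lra. exact N.
  - intros a b c m d _ _ [l H] [l' H']. exists (l ++ l'). intros u v Hu Hv N.
    apply in_or_app. destruct (Rle_dec v m).
    + left. apply H; try lra. exact N.
    + right. apply H'; try lra. exact N.
  - intros x y _ _. set (p := pt w1 w2 x y). eexists. split; [apply ord_eq_0_near|].
    intros a b c d K. exists (p :: nil). intros u v Hu Hv N. left.
    apply NNPP. intros N'. apply N. apply K; try assumption. intros E. apply N'. auto.
Qed.

(* At [z] in [l] the term [ord z / (z - z)] is [0], as Rocq's [/ 0] is [0]; this is
   just what makes the difference below agree with its holomorphic extension. *)
Definition principal_part (l : list C) (z : C) : C :=
  Csum (fun p => RtoC (IZR (ord p)) / (z - p))%C l.

Lemma Cdiv_0_r (c : C) : (c / RtoC 0)%C = RtoC 0.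
Proof. apply injective_projections; simpl; unfold Rdiv; ring. Qed.

(** Near [z0] the polar term of [lam] cancels against the term of [z0] in the sum. What remains is
    [h' z / h z] minus terms regular at [z0], and the choice of [lam z0] makes this true at [z0]
    itself. *)
Lemma lam_minus_principal_part (l : list C) (z0 : C) :
  NoDup l -> (forall p, In p l -> ord p <> 0%Z) -> (ord z0 <> 0%Z -> In z0 l) ->
  Cdifferentiable (fun z => lam z - principal_part l z)%C z0.
Proof.
  intros Hl Hl0 Hz0. destruct (ordlam z0) as [h [d [H [Hd El]]]].
  pose proof H as [Hh [hz0 _]].
  destruct (derivative_holomorphic w1 w2 D z0 h Hh) as [h' [Dh Hh']].
  set (l' := remove Ceq_dec z0 l).
  assert (Sum : forall z, principal_part l z =
    (RtoC (IZR (ord z0)) / (z - z0) +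
      Csum (fun p => RtoC (IZR (ord p)) / (z - p)) l')%C).
  { intros z. unfold principal_part. destruct (in_dec Ceq_dec z0 l) as [I|I].
    - rewrite (Csum_remove _ l z0) by assumption. reflexivity.
    - unfold l'. rewrite notin_remove by exact I.
      replace (ord z0) with 0%Z.
      + unfold Cdiv. rewrite Cmult_0_l, Cplus_0_l. reflexivity.
      + symmetry. apply NNPP. auto. }
  apply Cdifferentiable_ext with (fun z => h' z / h z -
    Csum (fun p => RtoC (IZR (ord p)) / (z - p)) l')%C.
  - generalize (log_derivative_near f z0 _ h h' H Dh). apply near_impl.
    intros z K. rewrite Sum. destruct (Ceq_dec z z0) as [->|N].
    + rewrite El, (is_Cderive_unique _ _ _ _ Hd (near_self _ _ Dh)).
      rewrite Cminus_diag. rewrite Cdiv_0_r. ring.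
    + destruct (log_derivative_unique f z _ _ _ (K N) (ordlam z)) as [_ ->]. ring.
  - apply Cdifferentiable_minus.
    + apply Cdifferentiable_div; [exact hz0| |]; apply near_self; assumption.
    + apply (Csum_Cdifferentiable (fun z p => RtoC (IZR (ord p)) / (z - p))%C).
      intros p Hp. apply Cdifferentiable_mult; [apply Cdifferentiable_const|].
      apply Cdifferentiable_inv_translate. intros E. subst p.
      apply (remove_In Ceq_dec l z0). exact Hp.
Qed.

Lemma bd_integral_principal_part (l : list C) (s1 s2 t1 t2 : R) :
  s1 < s2 -> t1 < t2 ->
  (forall p, In p l -> exists s t, p = pt w1 w2 s t /\ s1 < s < s2 /\ t1 < t < t2) ->
  bd_all w1 w2 s1 s2 t1 t2 (Ccontinuous_at (principal_part l)) /\
  bd_integral w1 w2 (principal_part l) s1 s2 t1 t2 =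
    (winding_const w1 w2 * RtoC (IZR (Zsum ord l)))%C.
Proof.
  intros Hs Ht. induction l as [|p l IH]; intros Hl.
  - split.
    + intros s t _. apply Ccontinuous_const.
    (* The empty sum is seen as an affine function, whose integral is known to vanish. *)
    + rewrite (bd_integral_ext w1 w2 _ (fun z => RtoC 0 + RtoC 0 * z)%C); try lra.
      * rewrite bd_integral_affine by lra. simpl. ring.
      * intros s t _. unfold principal_part. simpl. ring.
  - destruct IH as [IH1 IH2]; [intros q Hq; apply Hl; right; exact Hq|].
    destruct (Hl p) as [x [y [Ep [Hx Hy]]]]; [left; reflexivity|].
    assert (Cp : bd_all w1 w2 s1 s2 t1 t2 (Ccontinuous_at (fun z => / (z - p))%C)).
    { intros s t [Hs' [Ht' Hb]]. apply Cdifferentiable_continuous, Cdifferentiable_inv_translate.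
      intros E. rewrite Ep in E. apply pt_inj in E; [lra|exact D]. }
    assert (Cp' : bd_all w1 w2 s1 s2 t1 t2
      (Ccontinuous_at (fun z => RtoC (IZR (ord p)) * / (z - p))%C)).
    { intros s t Hst. apply Ccontinuous_mult; [apply Ccontinuous_const|apply Cp, Hst]. }
    split.
    + intros s t Hst. apply (Ccontinuous_plus (fun z => RtoC (IZR (ord p)) * / (z - p))%C
        (principal_part l)); [apply Cp', Hst|apply IH1, Hst].
    + change (principal_part (p :: l)) with
        (fun z => RtoC (IZR (ord p)) * / (z - p) + principal_part l z)%C.
      rewrite bd_integral_plus, bd_integral_scal, IH2 by (try lra; assumption).
      pose proof (winding w1 w2 D s1 s2 t1 t2 x y Hx Hy) as Wp. rewrite <- Ep in Wp.
      rewrite Wp.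
      simpl Zsum. rewrite plus_IZR, RtoC_plus. ring.
Qed.

Hypothesis per1 : forall z, f (z + w1)%C = f z.
Hypothesis per2 : forall z, f (z + w2)%C = f z.

(** The translated local form gives order [0] and value [lam z] at [z + w]; uniqueness identifies
    that value with the one chosen there. *)
Lemma lam_periodic (w z : C) :
  (forall z, f (z + w)%C = f z) -> ord z = 0%Z -> lam (z + w)%C = lam z.
Proof.
  intros per Hz. pose proof (ordlam z) as Lz. rewrite Hz in Lz.
  apply (log_derivative_unique f _ _ _ _
    (log_derivative_translate f w z (lam z) per Lz) (ordlam (z + w)%C)).
Qed.

Lemma sum_ord_eq_0 (l : list C) (e : R) :
  NoDup l -> (forall p, In p l -> ord p <> 0%Z) ->
  (forall p, In p l -> exists s t, p = pt w1 w2 s t /\ - e < s < 1 - e /\ - e < t < 1 - e) ->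
  box_all w1 w2 (- e) (1 - e) (- e) (1 - e) (fun z => ord z <> 0%Z -> In z l) ->
  Zsum ord l = 0%Z.
Proof.
  intros Hl Hl0 Hint Hbox.
  assert (Lt : - e < 1 - e) by lra.
  (* A singular boundary point would be listed, hence interior, against the uniqueness of
     coordinates. *)
  assert (Hbd : bd_all w1 w2 (- e) (1 - e) (- e) (1 - e) (fun z => ord z = 0%Z)).
  { intros s t [Hs [Ht Hb]]. apply NNPP. intros N.
    destruct (Hint _ (Hbox s t Hs Ht N)) as [x [y [E H]]].
    apply pt_inj in E; [lra|exact D]. }
  destruct (bd_integral_principal_part l _ _ _ _ Lt Lt Hint) as [CP JP].
  assert (HD : box_all w1 w2 (- e) (1 - e) (- e) (1 - e)
    (Cdifferentiable (fun z => lam z - principal_part l z)%C)).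
  { intros s t Hs Ht. apply lam_minus_principal_part; try assumption.
    apply Hbox; assumption. }
  assert (HC : bd_all w1 w2 (- e) (1 - e) (- e) (1 - e)
    (Ccontinuous_at (fun z => lam z - principal_part l z)%C)).
  { intros s t Hst. apply box_bd in HD. apply Cdifferentiable_continuous, HD, Hst. }
  assert (J1 : bd_integral w1 w2 lam (- e) (1 - e) (- e) (1 - e) =
    (winding_const w1 w2 * RtoC (IZR (Zsum ord l)))%C).
  { rewrite (bd_integral_ext w1 w2 _
      (fun z => (lam z - principal_part l z) + principal_part l z)%C); try lra.
    - rewrite bd_integral_plus, JP by (try lra; assumption).
      rewrite goursat by (try lra; assumption). ring.
    - intros s t _. ring. }
  assert (J2 : bd_integral w1 w2 lam (- e) (1 - e) (- e) (1 - e) = RtoC 0).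
  { destruct (bd_all_edges _ _ _ _ _ _ _ (Rlt_le _ _ Lt) (Rlt_le _ _ Lt) Hbd)
      as [B1 [_ [B3 _]]].
    unfold bd_integral.
    (* On the far edge [lam z] is replaced by [lam (z - w2)], allowed because orders vanish on the
       near edge. Both edges then have the same integrand in the parameter, with opposite signs in
       the contour. *)
    rewrite (edge_integral_ext lam (fun z => lam (z - w2)%C) w1 (RtoC (1 - e) * w2)) by
      (try lra; intros s Hs;
       replace (RtoC s * w1 + RtoC (1 - e) * w2)%C
         with (RtoC s * w1 + RtoC (- e) * w2 + w2)%C
         by (rewrite RtoC_minus, RtoC_opp; ring);
       rewrite lam_periodic by (try assumption; apply B1, Hs); f_equal; ring).
    rewrite (edge_integral_ext lam (fun z => lam (z - w1)%C) w2 (RtoC (1 - e) * w1)) by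
      (try lra; intros s Hs;
       replace (RtoC s * w2 + RtoC (1 - e) * w1)%C
         with (RtoC s * w2 + RtoC (- e) * w1 + w1)%C
         by (rewrite RtoC_minus, RtoC_opp; ring);
       rewrite lam_periodic by (try assumption; apply B3, Hs); f_equal; ring).
    unfold edge_integral.
    rewrite (CRInt_ext (fun s => lam (RtoC s * w1 + RtoC (1 - e) * w2 - w2)%C)
      (fun s => lam (RtoC s * w1 + RtoC (- e) * w2)%C)) by
      (try lra; intros s _; f_equal; rewrite RtoC_minus, RtoC_opp; ring).
    rewrite (CRInt_ext (fun s => lam (RtoC s * w2 + RtoC (1 - e) * w1 - w1)%C)
      (fun s => lam (RtoC s * w2 + RtoC (- e) * w1)%C)) by
      (try lra; intros s _; f_equal; rewrite RtoC_minus, RtoC_opp; ring).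
    ring. }
  rewrite J2 in J1. apply eq_IZR. apply RtoC_inj.
  destruct (Ceq_dec (RtoC (IZR (Zsum ord l))) (RtoC 0)) as [E|N]; [exact E|].
  destruct (Cmult_neq_0 _ _ (winding_const_neq_0 w1 w2 D) N). symmetry. exact J1.
Qed.

Lemma divisor_of_fundamental_parallelogram :
  exists l, NoDup l /\
    (forall p, In p l <-> fundamental_parallelogram w1 w2 p /\ ord p <> 0%Z) /\
    Zsum ord l = 0%Z.
Proof.
  (* This box contains the fundamental parallelogram and all its shifts with [e <= 1], so one list
     serves before [e] is chosen. *)
  destruct (singular_finite (-1) 1 (-1) 1) as [l0 H0]; [lra|lra|].
  assert (He : exists e, 0 < e <= 1 /\ forall p s t, In p l0 -> p = pt w1 w2 s t ->
    (~ (- e <= s < 0) /\ ~ (1 - e <= s < 1)) /\ (~ (- e <= t < 0) /\ ~ (1 - e <= t < 1))).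
  (* Allowing every smaller [e'] makes the claim inductive: the margins of the listed points are
     combined by taking the minimum. *)
  { assert (He' : exists e, 0 < e <= 1 /\ forall e', 0 < e' <= e ->
      forall p s t, In p l0 -> p = pt w1 w2 s t ->
      (~ (- e' <= s < 0) /\ ~ (1 - e' <= s < 1)) /\
      (~ (- e' <= t < 0) /\ ~ (1 - e' <= t < 1))).
    { clear H0. induction l0 as [|q l0 [e [He IH]]].
      - exists 1. split; [lra|]. intros e' _ p s t [].
      - destruct (pt_coordinates w1 w2 q D) as [x [y E]].
        destruct (exists_margin x) as [ex [Hex Kx]].
        destruct (exists_margin y) as [ey [Hey Ky]].
        exists (Rmin e (Rmin ex ey)).
        pose proof (Rmin_l e (Rmin ex ey)). pose proof (Rmin_r e (Rmin ex ey)).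
        pose proof (Rmin_l ex ey). pose proof (Rmin_r ex ey).
        split; [split; [repeat apply Rmin_pos|]; lra|].
        intros e' He' p s t [<-|Hp] Ep.
        + rewrite E in Ep. apply pt_inj in Ep; [|exact D]. destruct Ep as [<- <-].
          split; [apply Kx|apply Ky]; lra.
        + apply IH with p; try assumption. lra. }
    destruct He' as [e [He K]]. exists e. split; [exact He|]. apply K. lra. }
  destruct He as [e [He K]].
  set (sel := fun p => if excluded_middle_informative
    (fundamental_parallelogram w1 w2 p /\ ord p <> 0%Z) then true else false).
  assert (Hsel : forall p, sel p = true <->
    fundamental_parallelogram w1 w2 p /\ ord p <> 0%Z).
  { intros p. unfold sel. destruct excluded_middle_informative; split; try tauto; discriminate. }
  set (l := nodup Ceq_dec (filter sel l0)).
  assert (Hl : forall p, In p l <-> fundamental_parallelogram w1 w2 p /\ ord p <> 0%Z).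
  { intros p. unfold l. rewrite nodup_In, filter_In, Hsel. split; [tauto|].
    intros [[s [t [Hs [Ht Ep]]]] N]. split.
    - rewrite Ep. apply H0; try lra. unfold pt. rewrite <- Ep. exact N.
    - split; [|exact N]. exists s, t. auto. }
  assert (Hl' : forall p, In p l -> In p l0).
  { intros p Hp. unfold l in Hp. rewrite nodup_In, filter_In in Hp. tauto. }
  exists l. split; [apply NoDup_nodup|]. split; [exact Hl|].
  apply sum_ord_eq_0 with e.
  - apply NoDup_nodup.
  - intros p Hp. apply Hl, Hp.
  - intros p Hp. pose proof (proj1 (Hl p) Hp) as [[s [t [Hs [Ht Ep]]]] _].
    exists s, t. split; [exact Ep|]. destruct (K p s t (Hl' p Hp) Ep). lra.
  (* A singular point of the closed shifted box avoids [[- e, 0)] and [[1 - e, 1)] in both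
     coordinates, so these lie in [[0, 1 - e)]. *)
  - intros s t Hs Ht N. assert (Hp : In (pt w1 w2 s t) l0) by (apply H0; try lra; exact N).
    destruct (K _ s t Hp eq_refl). apply Hl. split; [|exact N].
    exists s, t. split; [lra|]. split; [lra|reflexivity].
Qed.

(** * Counting zeros and poles from the orders *)

Lemma count_filter (sel : C -> bool) (mult : C -> nat) (l : list C) :
  map fst (map (fun p => (p, mult p)) (filter sel l)) = filter sel l.
Proof. rewrite map_map. apply map_id. Qed.

Lemma zeros_minus_poles (l : list C) :
  (Z.of_nat (list_sum (map snd (map (fun p => (p, Z.to_nat (ord p)))
     (filter (fun p => 0 <? ord p)%Z l)))) -
   Z.of_nat (list_sum (map snd (map (fun p => (p, Z.to_nat (- ord p)))
     (filter (fun p => ord p <? 0)%Z l)))))%Z = Zsum ord l.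
Proof.
  induction l as [|p l IH]; [reflexivity|].
  simpl. destruct (Z.ltb_spec 0 (ord p)), (Z.ltb_spec (ord p) 0); simpl; lia.
Qed.

Lemma zeros_eq_poles : exists N : nat,
  number_of_zeros (fundamental_parallelogram w1 w2) f N /\
  number_of_poles (fundamental_parallelogram w1 w2) f N.
Proof.
  destruct divisor_of_fundamental_parallelogram as [l [Hl [Il Sl]]].
  assert (pos : forall p, (0 < ord p)%Z ->
    f p = Some (RtoC 0) /\ zero_of_order f p (Z.to_nat (ord p))).
  { intros p Hp. destruct (ordlam p) as [h [d [H _]]].
    apply ord_data_pos with h; assumption. }
  assert (neg : forall p, (ord p < 0)%Z ->
    f p = None /\ pole_of_order f p (Z.to_nat (- ord p))).
  { intros p Hp. destruct (ordlam p) as [h [d [H _]]].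
    apply ord_data_neg with h; assumption. }
  assert (reg : forall p, ord p = 0%Z -> exists c, c <> RtoC 0 /\ f p = Some c).
  { intros p Hp. apply (log_derivative_0_value f p (lam p)). rewrite <- Hp. apply ordlam. }
  assert (zero : forall p, f p = Some (RtoC 0) <-> (0 < ord p)%Z).
  { intros p. split; [|apply pos]. intros E.
    destruct (Z.lt_trichotomy (ord p) 0) as [K|[K|K]]; [|..|exact K].
    - destruct (neg p K). congruence.
    - destruct (reg p K) as [c [c0 Ec]]. congruence. }
  assert (pole : forall p, f p = None <-> (ord p < 0)%Z).
  { intros p. split; [|apply neg]. intros E.
    destruct (Z.lt_trichotomy (ord p) 0) as [K|[K|K]]; [exact K|..].
    - destruct (reg p K) as [c [c0 Ec]]. congruence.
    - destruct (pos p K). congruence. }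
  pose proof (zeros_minus_poles l) as E. rewrite Sl in E.
  (* [N] becomes the sum of the positive orders; for the poles, [E] says that the negative ones have
     the same total. *)
  eexists. split.
  - exists (map (fun p => (p, Z.to_nat (ord p))) (filter (fun p => 0 <? ord p)%Z l)).
    rewrite count_filter. split; [apply NoDup_filter, Hl|]. split; [|split; [|reflexivity]].
    + intros p. rewrite filter_In, Il, zero, Z.ltb_lt. split; [tauto|].
      intros [H1 H2]. split; [split; [exact H1|lia]|exact H2].
    + intros p m H. apply in_map_iff in H. destruct H as [q [Eq Hq]].
      injection Eq as -> <-. apply filter_In in Hq. apply pos, Z.ltb_lt, Hq.
  - exists (map (fun p => (p, Z.to_nat (- ord p))) (filter (fun p => ord p <? 0)%Z l)).
    rewrite count_filter. split; [apply NoDup_filter, Hl|]. split; [|split; [|lia]].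
    + intros p. rewrite filter_In, Il, pole, Z.ltb_lt. split; [tauto|].
      intros [H1 H2]. split; [split; [exact H1|lia]|exact H2].
    + intros p m H. apply in_map_iff in H. destruct H as [q [Eq Hq]].
      injection Eq as -> <-. apply filter_In in Hq. apply neg, Z.ltb_lt, Hq.
Qed.

End Elliptic.

(** The imaginary part of [w1 / w2] is [- cross w1 w2] over the squared modulus of [w2]. For
    [w2 = 0] the quotient is [0] by convention, so that case is excluded by the same hypothesis. *)
Lemma cross_neq_0 (w1 w2 : C) :
  ~ (exists r : R, (w1 / w2)%C = RtoC r) -> cross w1 w2 <> 0.
Proof.
  intros H E. apply H. exists (fst (w1 / w2)%C).
  apply injective_projections; [reflexivity|].
  unfold cross in E. cbn. unfold Rdiv.
  replace (fst w1 * (- snd w2 * / (fst w2 * (fst w2 * 1) + snd w2 * (snd w2 * 1))) +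
    snd w1 * (fst w2 * / (fst w2 * (fst w2 * 1) + snd w2 * (snd w2 * 1)))) with
    (- (fst w1 * snd w2 - snd w1 * fst w2) *
      / (fst w2 * (fst w2 * 1) + snd w2 * (snd w2 * 1))) by ring.
  rewrite E. ring.
Qed.

Theorem theorem2p2 (w1 w2 : C) (f : C -> option C)
  (hw : ~ exists r : R, (w1 / w2)%C = RtoC r)
  (hf : elliptic w1 w2 f)
  (hf0 : ~ forall z : C, f z = Some (RtoC 0)) :
  exists N : nat,
    number_of_zeros (fundamental_parallelogram w1 w2) f N /\
    number_of_poles (fundamental_parallelogram w1 w2) f N.
Proof.
  destruct hf as [mf per]. pose proof (cross_neq_0 w1 w2 hw) as D.
  pose proof (not_locally_zero w1 w2 D f mf hf0) as nz.
  destruct (ord_log_derivative_exist w1 w2 D f mf nz) as [ord [lam H]].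
  apply (zeros_eq_poles w1 w2 D f ord lam H); intros z; apply per.
Qed.
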